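(* Assume that there is a non-increasing function $\eta$ on $[0,+\infty[$ such that for all bounded $f$ and all $t\ge 0$, $$\mathrm{Var}_\mu(P_t f) \leq \eta(t) \, \Big\| f - \int f d\mu\Big\|_\infty^2 .$$ Let $\alpha(s)=\sqrt{\eta(s)}$ or, in the case where $\mu$ is symmetric, either $\alpha(s)=\sqrt{\eta(s)}$ or $\alpha(s)=\eta(s/2)$. Assume that $\alpha(s)=c\, e^{-c' s^{p/(2-p)}}$ for some $0<p\leq 1$ and constants $c,c'>0$. Then there exists a constant $k_0$, depending on $c$, such that for all measurable $V$ with $\sup |V|= 1$, all $0<R\leq 1$ and all $t<[t]/(1-R)$, where $[t]$ is the integer part of $t$, $$\mathbb{P}_\mu\left(\frac 1t \int_0^t V(X_s) ds - \int V d\mu \geq R\right) \leq \exp \left\{ - c(p) \left(\big(R-(1-([t]/t))\big) \sqrt t\right)^p \right\},$$ with $$c(p) = \frac{2-p}{p}\left(\frac12\right)^p \left(\frac{pc'}{2-p}\right)^{\frac{2-p}{2}},$$ provided $$\big(R-(1-([t]/t))\big) \sqrt t \;\geq\; 2\, k_0^{1/p} \left(\frac{2-p}{pc'}\right)^{\frac{2-p}{2p}} .$$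
   Context: $E$ is a Polish space and $(X_t,(\mathbb{P}_x)_{x\in E})$ is a conservative continuous-time Markov process on $E$ with semigroup $(P_t)_{t\ge 0}$. $\mu$ is a probability measure on $E$ that is invariant and ergodic for $(P_t)$; $\mathbb{P}_\mu$ is the law of the process with initial law $\mu$; $\mu$ is symmetric if each $P_t$ is self-adjoint in $\mathbb{L}^2(\mu)$. $\mathrm{Var}_\mu(f)=\int f^2d\mu-(\int f d\mu)^2$. The condition $t<[t]/(1-R)$ means $t>0$ and $R-(1-[t]/t)>0$ (for $R=1$ it reads $[t]\ge 1$). *)

(* Defs.v *)
(* MathComp-Analysis *)
From HB Require Import structures.
From mathcomp Require Import all_boot all_order all_algebra.
From mathcomp Require Import all_classical all_reals all_analysis.

Set Implicit Arguments.
Unset Strict Implicit.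
Unset Printing Implicit Defensive.
Import Order.TTheory GRing.Theory Num.Theory.
Import numFieldNormedType.Exports.

Local Open Scope classical_set_scope.
Local Open Scope ring_scope.

Notation borelType E := (g_sigma_algebraType (@open E)).

Definition is_metric (R : realType) (E : Type) (d : E -> E -> R) : Prop :=
  [/\ forall x y, (d x y = 0) <-> (x = y),
      forall x y, d x y = d y x &
      forall x y z, d x z <= d x y + d y z].

Definition metrizes (R : realType) (E : topologicalType) (d : E -> E -> R)
    : Prop :=
  forall (x : E) (A : set E),
    nbhs x A <-> exists2 e : R, 0 < e & [set y | d x y < e] `<=` A.

Definition complete_metric (R : realType) (E : topologicalType)
    (d : E -> E -> R) : Prop :=
  forall u : nat -> E,
    (forall e : R, 0 < e -> exists N : nat,
       forall m n, (N <= m)%N -> (N <= n)%N -> d (u m) (u n) < e) ->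
    exists l : E, u @ \oo --> l.

Definition polish (R : realType) (E : topologicalType) : Prop :=
  (exists2 D : set E, countable D & dense D) /\
  (exists d : E -> E -> R, [/\ is_metric d, metrizes d & complete_metric d]).

Section markov.
Context (R : realType) (dE dO : measure_display).
Context (E : measurableType dE) (Om : measurableType dO).
Implicit Types (X : R -> Om -> E) (Px : R.-pker E ~> Om).
Implicit Type mu : probability E R.

(* The events generated by X_u, 0 <= u <= s. *)
Definition past X (s : R) : set (set Om) :=
  <<s [set A | exists u (B : set E),
         [/\ 0 <= u <= s, measurable B & A = X u @^-1` B]] >>.

(* Times are real numbers, of which only the nonnegative ones matter. Since
   every Px x is a probability and X takes its values in E, the process is
   conservative. Joint measurability in (s, w) is what gives a meaning to
   \int_0^t V(X_s) ds for an arbitrary measurable V. *)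
Definition markov_process X Px : Prop :=
  [/\ measurable_fun
        ([set q | 0 <= q.1] : set (measurableTypeR R * Om))
        (fun q : measurableTypeR R * Om => X q.1 q.2),
      forall (x : E) (B : set E), measurable B ->
        Px x (X 0 @^-1` B) = \d_x B &
      forall (x : E) (s t : R) (A : set Om) (B : set E),
        0 <= s -> 0 <= t -> past X s A -> measurable B ->
        Px x (A `&` X (s + t) @^-1` B) =
          (\int[Px x]_(w in A) Px (X s w) (X t @^-1` B))%E].

Definition semigroup X Px (t : R) (f : E -> R) : E -> R :=
  fun x => \int[Px x]_w f (X t w).

Definition law_from Px mu (A : set Om) : \bar R := (\int[mu]_x Px x A)%E.

Definition invariant_measure X Px mu : Prop :=
  forall (t : R) (B : set E), 0 <= t -> measurable B ->
    (\int[mu]_x Px x (X t @^-1` B))%E = mu B.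

Definition ergodic_measure X Px mu : Prop :=
  forall B : set E, measurable B ->
    (forall t : R, 0 <= t ->
       {ae mu, forall x, semigroup X Px t \1_B x = \1_B x}) ->
    mu B = 0%E \/ mu B = 1%E.

Definition symmetric_measure X Px mu : Prop :=
  forall (t : R) (f g : E -> R), 0 <= t ->
    f \in Lfun mu 2%:E -> g \in Lfun mu 2%:E ->
    \int[mu]_x (semigroup X Px t f x * g x) =
      \int[mu]_x (f x * semigroup X Px t g x).

Definition variance_under mu (f : E -> R) : R :=
  \int[mu]_x (f x ^+ 2) - (\int[mu]_x f x) ^+ 2.

End markov.

(* [sup A] is 0 when A is empty or unbounded above, so [supnorm f = 1] does
   entail that f is bounded. *)
Definition supnorm (R : realType) (T : Type) (f : T -> R) : R :=
  sup (range (fun x => `|f x|)).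

(* R - (1 - [t]/t) *)
Definition reduced_level (R : realType) (r t : R) : R :=
  r - (1 - (Num.floor t)%:~R / t).

(* Main.v *)
Require Import Defs.
From HB Require Import structures.
From mathcomp Require Import all_boot all_order all_algebra.
From mathcomp Require Import all_classical all_reals all_analysis.
From mathcomp Require Import measurable_realfun ring lra.

Set Implicit Arguments.
Unset Strict Implicit.
Unset Printing Implicit Defensive.
Import Order.TTheory GRing.Theory Num.Theory.
Import numFieldNormedType.Exports.

Local Open Scope classical_set_scope.
Local Open Scope ring_scope.

(** Write [b = (2 - p) / p], [tau = (b / c') `^ b] and [rho = reduced_level r t].
    The rate is [alpha s = c * exp (- b * (s / tau) ^ (1 / b))], and if [N] is
    defined by [rho ^ 2 * t = 4 * tau * N ^ (b + 1)] the claim is that the deviation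
    has probability at most [exp (- b * N)] as soon as [N >= k0]. A time
    [tau * N ^ b] brings [alpha] down to [c * exp (- b * N)]: correlations over such
    a time are as small as the bound to be proved, and [t] contains [4 * N / rho ^ 2] such
    times. Since [rho <= r], it suffices to bound the probability that
    the integral [S_t] of the centred function [f = V - int V dmu] along the path
    exceeds [rho * t].

    Both choices of [alpha] control the semigroup from the uniform norm to L^1(mu)
    ([semigroup_L1]). With the Markov property this makes the expectation of
    [Phi (S_s) * g (X_(s+v))] equal to [E Phi (S_s) * int g dmu] up to
    [4 * sup |Phi| * sup |g| * alpha v] ([decorrelate]). The Markov property is
    required here for a functional of the whole path up to time [s];
    [markov_functional] obtains it from Fubini's theorem and from the approximation
    of [Phi] by polynomials.

    Cut [0, t] into equal blocks of length [l] slightly above [tau * N ^ b / rho], and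
    follow the mean of [F (lam * (S - x0))] from block to block, where [F] is
    [expquad] and [x0 = rho * t / 2]. In the second order expansion
    [expquad_two_steps] the first derivative is evaluated one block before the
    increment that it multiplies, so that its contribution is of order [alpha l]. The
    second derivative is evaluated one block before the two increments that it
    multiplies; it decorrelates from them, and by [block_second_moment] the result is
    the mean of [F] times [lam ^ 2 * l * int alpha], up to a constant and again up to
    [alpha l]. A discrete Gronwall inequality and Markov's inequality then give
    [block_deviation].

    The shape of [F] matters. On the left of [x0] it is exponential, so that the
    initial value is [exp (- lam * x0)]. On the right it is quadratic: its first two
    derivatives are bounded by a polynomial, so the decorrelation errors are multiplied
    by powers of [b * N / rho] only, and the powers of [b] cancel against the value
    [2 * (b * N) ^ 2] of [F] at the level [rho * t] used in Markov's inequality. An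
    exponential on both sides would multiply [alpha l], which is all that is known
    to be small, by an exponential.

    With [lam * rho * t = 4 * b * N] the initial value is about [exp (- 2 * b * N)].
    The factor [e / rho] in the length of the blocks makes
    [alpha l <= c * exp (- b * N - N) * rho ^ 2] ([rate_block]), where [exp (- N)]
    absorbs all constants once [N] is large in terms of [c]. The total growth is
    [exp (C * b ^ 2 * N ^ (1 - b) * exp (12 * e * b))] with [C] proportional to [c],
    which is bounded uniformly in [b >= 1] for large [N] ([powR_dominates]). Hence the
    threshold depends on [c] alone ([deviation_arithmetic]). *)

(** * Bounded measurable functions and their expectations *)

Definition bounded_mfun d (T : measurableType d) (R : realType) (f : T -> R) :=
  measurable_fun [set: T] f /\ exists M, forall x, `|f x| <= M.

Section bounded_mfun.
Context d (T : measurableType d) (R : realType).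
Implicit Types f g : T -> R.

Lemma bounded_mfun_cst (a : R) : bounded_mfun (fun _ : T => a).
Proof. by split; [exact: measurable_cst | exists `|a|]. Qed.

Lemma bounded_mfunD f g : bounded_mfun f -> bounded_mfun g ->
  bounded_mfun (fun x => f x + g x).
Proof.
move=> [mf [M fM]] [mg [N gN]]; split; first exact: measurable_funD.
by exists (M + N) => x; rewrite (le_trans (ler_normD _ _))// lerD.
Qed.

Lemma bounded_mfunM f g : bounded_mfun f -> bounded_mfun g ->
  bounded_mfun (fun x => f x * g x).
Proof.
move=> [mf [M fM]] [mg [N gN]]; split; first exact: measurable_funM.
by exists (M * N) => x; rewrite normrM ler_pM.
Qed.

Lemma bounded_mfunZ a f : bounded_mfun f -> bounded_mfun (fun x => a * f x).
Proof. exact/bounded_mfunM/bounded_mfun_cst. Qed.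

Lemma bounded_mfunB f g : bounded_mfun f -> bounded_mfun g ->
  bounded_mfun (fun x => f x - g x).
Proof.
move=> bf bg; have := bounded_mfunD bf (bounded_mfunZ (-1) bg).
by under [X in bounded_mfun X -> _]eq_fun do rewrite mulN1r.
Qed.

Lemma bounded_mfun_norm f : bounded_mfun f -> bounded_mfun (fun x => `|f x|).
Proof.
move=> [mf [M fM]]; split; first exact: measurableT_comp.
by exists M => x; rewrite normr_id.
Qed.

Lemma bounded_mfun_indic (A : set T) : measurable A ->
  bounded_mfun (\1_A : T -> R).
Proof.
move=> mA; split; first exact: measurable_indic.
by exists 1 => x; rewrite indicE; case: (_ \in _); rewrite ?normr1 ?normr0.
Qed.

Lemma bounded_mfun_comp (phi : R -> R) f : continuous phi ->
  bounded_mfun f -> (exists M, forall x, `|phi (f x)| <= M) ->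
  bounded_mfun (fun x => phi (f x)).
Proof.
move=> cphi [mf _] ?; split => //.
by apply: measurableT_comp => //; exact: continuous_measurable_fun.
Qed.

Lemma bounded_mfun_pos f : bounded_mfun f -> exists2 M, 0 < M & forall x, `|f x| <= M.
Proof.
move=> [_ [M fM]]; exists (`|M| + 1); first by rewrite ltr_wpDl.
by move=> x; rewrite (le_trans (fM x))// (le_trans (ler_norm _))// lerDl.
Qed.

Lemma measurable_le_set f g : measurable_fun [set: T] f ->
  measurable_fun [set: T] g -> measurable [set x | f x <= g x].
Proof.
move=> mf mg; have := measurable_fun_ler mf mg => /(_ measurableT [set true] I).
rewrite setTI; congr (measurable _).
Qed.

Lemma measurable_lt_set f g : measurable_fun [set: T] f ->
  measurable_fun [set: T] g -> measurable [set x | f x < g x].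
Proof.
move=> mf mg; have := measurable_fun_ltr mf mg => /(_ measurableT [set true] I).
rewrite setTI; congr (measurable _).
Qed.

End bounded_mfun.

(** Measures of total mass one, rather than probabilities, so that the values of a
    kernel are covered. *)
Section expectation.
Context d (T : measurableType d) (R : realType).
Variable P : {measure set T -> \bar R}.
Hypothesis P1 : P setT = 1%E.
Implicit Types f g : T -> R.

Lemma bounded_mfun_integrable f : bounded_mfun f -> P.-integrable setT (EFin \o f).
Proof.
move=> [mf [M fM]]; apply: measurable_bounded_integrable => //.
  by rewrite P1 ltey.
exists M; split; first exact: num_real.
by move=> x Mx y _; apply: le_trans (fM y) _; exact: ltW.
Qed.

Lemma expectD f g : bounded_mfun f -> bounded_mfun g ->
  \int[P]_x (f x + g x) = \int[P]_x f x + \int[P]_x g x.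
Proof. by move=> bf bg; rewrite RintegralD//; exact: bounded_mfun_integrable. Qed.

Lemma expectB f g : bounded_mfun f -> bounded_mfun g ->
  \int[P]_x (f x - g x) = \int[P]_x f x - \int[P]_x g x.
Proof. by move=> bf bg; rewrite RintegralB//; exact: bounded_mfun_integrable. Qed.

Lemma expectZ a f : bounded_mfun f ->
  \int[P]_x (a * f x) = a * \int[P]_x f x.
Proof. by move=> bf; rewrite RintegralZl//; exact: bounded_mfun_integrable. Qed.

Lemma expect_cst a : \int[P]_x a = a.
Proof. by rewrite Rintegral_cst// P1 mulr1. Qed.

Lemma le_expect f g : bounded_mfun f -> bounded_mfun g ->
  (forall x, f x <= g x) -> \int[P]_x f x <= \int[P]_x g x.
Proof.
by move=> bf bg fg; apply: le_Rintegral => //; exact: bounded_mfun_integrable.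
Qed.

Lemma le_norm_expect f : bounded_mfun f ->
  `|\int[P]_x f x| <= \int[P]_x `|f x|.
Proof. by move=> bf; apply: le_normr_Rintegral => //; exact: bounded_mfun_integrable. Qed.

Lemma norm_expect_le f M : bounded_mfun f -> (forall x, `|f x| <= M) ->
  `|\int[P]_x f x| <= M.
Proof.
move=> bf fM; apply: le_trans (le_norm_expect bf) _.
rewrite -[leRHS]expect_cst; apply: le_expect => //.
  exact: bounded_mfun_norm.
exact: bounded_mfun_cst.
Qed.

Lemma expect_indic A : measurable A -> \int[P]_x \1_A x = fine (P A).
Proof. by move=> mA; rewrite /Rintegral integral_indic// setIT. Qed.

Lemma EFin_expect f : bounded_mfun f ->
  (\int[P]_x f x)%:E = (\int[P]_x (f x)%:E)%E.
Proof.
move=> bf; rewrite /Rintegral fineK//.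
exact: (integrable_fin_num _ (bounded_mfun_integrable bf)).
Qed.

Lemma expect_ge0 f : (forall x, 0 <= f x) -> 0 <= \int[P]_x f x.
Proof. by move=> f0; apply: Rintegral_ge0. Qed.

End expectation.

(** The integer part of [z] as a sum of indicators. *)
Lemma layer_count (R : realType) (z : R) (K : nat) : 0 <= z ->
  let S := \sum_(k < K) (k.+1%:R <= z)%R%:R : R in
  (K%:R <= z -> S = K%:R) /\ (z < K%:R -> S <= z < S + 1).
Proof.
move=> z0; elim: K => [|K [IH1 IH2]] /=.
  rewrite big_ord0; split => // /(le_lt_trans z0); by rewrite ltxx.
rewrite big_ord_recr/=; split => [Kz|zK].
  rewrite Kz IH1 ?natr1//; apply: le_trans Kz; by rewrite ler_nat.
rewrite (leNgt K.+1%:R) zK/= addr0; have [Kz|] := leP K%:R z; last exact: IH2.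
by rewrite IH1// Kz natr1.
Qed.

(** A bounded [f] is the uniform limit of the simple functions
    [floor (n * f) / n]. Identities between expectations are proved below by
    applying this to the difference of the two sides, which leaves only the case
    of indicators. *)
Lemma linear_functional_eq0 d (T : measurableType d) (R : realType)
    (L : (T -> R) -> R) (C : R) :
  (forall f g, bounded_mfun f -> bounded_mfun g ->
     L (fun x => f x + g x) = L f + L g) ->
  (forall a f, bounded_mfun f -> L (fun x => a * f x) = a * L f) ->
  (forall M f, bounded_mfun f -> (forall x, `|f x| <= M) -> `|L f| <= C * M) ->
  (forall A, measurable A -> L \1_A = 0) ->
  forall f, bounded_mfun f -> L f = 0.
Proof.
move=> LD LZ LM L1 f bf.
have [M M0 fM] := bounded_mfun_pos bf.
have L0 : L (fun=> 0) = 0.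
  by have := L1 set0 measurable0; rewrite indic0.
have Lc a : L (fun=> a) = 0.
  transitivity (L (fun x : T => a * \1_setT x)).
    by congr L; apply/funext => x; rewrite indicE in_setT mulr1.
  by rewrite LZ ?L1 ?mulr0//; exact: bounded_mfun_indic.
pose A n k := [set x | k.+1%:R <= n.+1%:R * (f x + M)].
have mA n k : measurable (A n k).
  have m1 : measurable_fun setT (fun x => n.+1%:R * (f x + M)).
    by case: (bounded_mfunZ n.+1%:R (bounded_mfunD bf (bounded_mfun_cst T M))).
  exact: (measurable_le_set (measurable_cst _) m1).
have bS n K : bounded_mfun (fun x => \sum_(k < K) \1_(A n k) x : R) /\
   L (fun x => \sum_(k < K) \1_(A n k) x) = 0.
  elim: K => [|K [IH1 IH2]].
    under eq_fun do rewrite big_ord0.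
    by split => //; exact: bounded_mfun_cst.
  under eq_fun do rewrite big_ord_recr/=.
  have bK := bounded_mfun_indic R (mA n K).
  by split; [exact: bounded_mfunD | rewrite LD// IH2 L1// addr0].
have key n : `|L f| <= C * n.+1%:R^-1.
  pose K := (Num.trunc (n.+1%:R * (M + M))).+1.
  have [bSK LSK] := bS n K.
  pose g x := (f x + M) + (- n.+1%:R^-1) * \sum_(k < K) \1_(A n k) x.
  have bg : bounded_mfun g.
    by apply: bounded_mfunD; [apply: bounded_mfunD => //; exact: bounded_mfun_cst|
      exact: bounded_mfunZ].
  have -> : L f = L g.
    rewrite /g LD//; last 2 first.
    - by apply: bounded_mfunD => //; exact: bounded_mfun_cst.
    - exact: bounded_mfunZ.
    rewrite LD//; last exact: bounded_mfun_cst.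
    by rewrite LZ// LSK mulr0 Lc !addr0.
  apply: LM => // x; rewrite /g.
  have n0 : 0 < n.+1%:R :> R by rewrite ltr0n.
  have := fM x; rewrite ler_norml => /andP[f1 f2].
  have z0 : 0 <= n.+1%:R * (f x + M).
    by rewrite mulr_ge0// -lerBlDr sub0r.
  have zK : n.+1%:R * (f x + M) < K%:R.
    apply: (@le_lt_trans _ _ (n.+1%:R * (M + M))).
      by rewrite ler_pM2l// lerD2r.
    by rewrite /K Num.Theory.truncnS_gt.
  have [_ /(_ zK)] := layer_count K z0.
  rewrite (eq_bigr (fun k : 'I_K => (\1_(A n k) x : R))); last first.
    move=> k _; rewrite indicE; congr (_%:R); apply/esym.
    by rewrite /A; case: leP => h; [rewrite mem_set | rewrite memNset//= ; apply/negP; rewrite -ltNge].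
  set S := \sum_(_ < _) _ => /andP[h1 h2].
  clearbody S; move: n0 h1 h2; move: (n.+1%:R : R) => a a0 h1 h2.
  have an0 : a != 0 by rewrite gt_eqF.
  rewrite ler_norml; apply/andP; split.
    rewrite -subr_ge0; have -> : f x + M + - a^-1 * S - - a^-1 =
       a^-1 * (a * (f x + M) - S + 1) by field.
    by rewrite mulr_ge0// ?invr_ge0 ?(ltW a0)//; lra.
  rewrite -subr_ge0; have -> : a^-1 - (f x + M + - a^-1 * S) =
       a^-1 * (1 - (a * (f x + M) - S)) by field.
    by rewrite mulr_ge0// ?invr_ge0 ?(ltW a0)//; lra.
apply/eqP; rewrite -normr_eq0 eq_le normr_ge0 andbT; apply/ler_addgt0Pr => e e0.
rewrite add0r.
have C0 : 0 <= C by have := key 0%N; rewrite invr1 mulr1; exact: le_trans.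
pose n := Num.trunc (C / e).
apply: le_trans (key n) _.
rewrite ler_pdivrMr ?ltr0n// mulrC -ler_pdivrMr// ltW//.
by rewrite /n Num.Theory.truncnS_gt.
Qed.
(** * The Markov property for bounded functions *)

Definition past_events (R : realType) (dE dO : measure_display)
    (E : measurableType dE) (Om : measurableType dO) (X : R -> Om -> E) (s : R)
    : set (set Om) :=
  [set A | exists u (B : set E),
     [/\ 0 <= u <= s, measurable B & A = X u @^-1` B]].

(** Bounded functions of the process up to time [s]: measurability refers to
    the type [Om] equipped with the sigma-algebra of the past. *)
Definition past_bounded (R : realType) (dE dO : measure_display)
    (E : measurableType dE) (Om : measurableType dO) (X : R -> Om -> E) (s : R)
    (Y : Om -> R) :=
  @bounded_mfun _ (g_sigma_algebraType (past_events X s)) R Y.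

(** The Markov property of [markov_process], which holds under every [Px x] and
    is inherited by their mixtures. *)
Definition markov_under (R : realType) (dE dO : measure_display)
    (E : measurableType dE) (Om : measurableType dO)
    (X : R -> Om -> E) (Px : R.-pker E ~> Om) (Q : {measure set Om -> \bar R}) :=
  forall (s t : R) (A : set Om) (B : set E),
    0 <= s -> 0 <= t -> past X s A -> measurable B ->
    Q (A `&` X (s + t) @^-1` B) =
      (\int[Q]_(w in A) Px (X s w) (X t @^-1` B))%E.

Lemma measurable_nonneg_times (R : realType) (dO : measure_display)
    (Om : measurableType dO) :
  measurable ([set q | 0 <= q.1] : set (measurableTypeR R * Om)).
Proof.
rewrite (_ : mkset _ = `[0, +oo[%classic `*` setT); last first.
  by apply/seteqP; split => -[u w] /=; rewrite in_itv/= andbT => //; case.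
exact: measurableX.
Qed.

Lemma joint_measurable_section (R : realType) (dE dO : measure_display)
    (E : measurableType dE) (Om : measurableType dO) (X : R -> Om -> E) :
  measurable_fun ([set q | 0 <= q.1] : set (measurableTypeR R * Om))
    (fun q : measurableTypeR R * Om => X q.1 q.2) ->
  forall t, 0 <= t -> measurable_fun [set: Om] (X t).
Proof.
move=> mX t t0.
apply: (measurable_comp (F := [set q : measurableTypeR R * Om | 0 <= q.1])
  (f := fun q : measurableTypeR R * Om => X q.1 q.2)
  (g := fun w : Om => (t, w))) => //.
- exact: measurable_nonneg_times.
- by move=> _ [w _ <-].
- by apply: measurable_fun_pair; [exact: measurable_cst|exact: measurable_id].
Qed.

Section markov_property.
Context (R : realType) (dE dO : measure_display).
Context (E : measurableType dE) (Om : measurableType dO).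
Variables (X : R -> Om -> E) (Px : R.-pker E ~> Om).
Hypothesis markovX : markov_process X Px.
Implicit Types (s t u : R) (f g : E -> R).

Lemma measurable_process (t : R) : 0 <= t -> measurable_fun [set: Om] (X t).
Proof. by have [mX _ _] := markovX; exact: joint_measurable_section. Qed.

Lemma bounded_process t (g : E -> R) : 0 <= t -> bounded_mfun g ->
  bounded_mfun (fun w => g (X t w)).
Proof.
move=> t0 [mg [M gM]]; split; last by exists M.
by apply: measurableT_comp => //; exact: measurable_process.
Qed.

Lemma norm_semigroup_le t (g : E -> R) M x : 0 <= t -> bounded_mfun g ->
  (forall y, `|g y| <= M) -> `|semigroup X Px t g x| <= M.
Proof.
move=> t0 bg gM; apply: norm_expect_le => //; first exact: prob_kernel.
exact: bounded_process.
Qed.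

Lemma kernel_expect_bounded (h : Om -> R) : bounded_mfun h ->
  bounded_mfun (fun x => \int[Px x]_w h w).
Proof.
move=> bh; have [M M0 hM] := bounded_mfun_pos bh.
split; last by exists M => x; apply: norm_expect_le => //; exact: prob_kernel.
have -> : (fun x => \int[Px x]_w h w) = fun x =>
    fine (\int[Px x]_w (h w + M)%:E)%E - M.
  apply/funext => x.
  rewrite -[fine _]/(\int[Px x]_w (h w + M)) expectD//.
  - by rewrite expect_cst ?addrK//; exact: prob_kernel.
  - exact: prob_kernel.
  - exact: bounded_mfun_cst.
apply: measurable_funB; last exact: measurable_cst.
apply: (measurableT_comp (fine_measurable measurableT)).
apply: (measurable_fun_integral_kernel
  (fun U mU => measurable_kernel Px U mU)) => [w|].
  by rewrite lee_fin -lerBlDr sub0r; have := hM w; rewrite ler_norml => /andP[].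
by apply/measurable_EFinP; apply: measurable_funD => //; case: bh.
Qed.

Lemma semigroup_bounded t (g : E -> R) : 0 <= t -> bounded_mfun g ->
  bounded_mfun (semigroup X Px t g).
Proof. by move=> t0 bg; apply/kernel_expect_bounded/bounded_process. Qed.

Lemma semigroup_indic t (B : set E) x : 0 <= t -> measurable B ->
  semigroup X Px t \1_B x = fine (Px x (X t @^-1` B)).
Proof.
move=> t0 mB; rewrite /semigroup -expect_indic//.
by rewrite -[_ @^-1` _]setTI; exact: measurable_process.
Qed.

Lemma past_measurable s A : past X s A -> measurable A.
Proof.
apply: smallest_sub; first exact: sigma_algebra_measurable.
move=> _ [u [B [/andP[u0 _] mB ->]]].
by rewrite -[_ @^-1` _]setTI; exact: measurable_process.
Qed.

Lemma past_bounded_mfun s Y : past_bounded X s Y -> bounded_mfun Y.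
Proof.
move=> [mY bY]; split => // _ B mB; have := mY measurableT B mB.
rewrite !setTI; exact: past_measurable.
Qed.

Lemma past_bounded_process u s f : 0 <= u <= s -> bounded_mfun f ->
  past_bounded X s (fun w => f (X u w)).
Proof.
move=> us [mf [M fM]]; split; last by exists M.
move=> _ B mB; rewrite setTI; apply: sub_sigma_algebra.
exists u, (f @^-1` B); split => //.
by rewrite -[_ @^-1` _]setTI; exact: mf.
Qed.

Section mixture.
Variable Q : {measure set Om -> \bar R}.
Hypothesis Q1 : Q setT = 1%E.
Hypothesis markovQ : markov_under X Px Q.

Lemma markov_indic s t A (g : E -> R) : 0 <= s -> 0 <= t -> past X s A ->
  bounded_mfun g ->
  \int[Q]_w (\1_A w * g (X (s + t) w)) =
  \int[Q]_w (\1_A w * semigroup X Px t g (X s w)).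
Proof.
move=> s0 t0 pA bg; have mA := past_measurable pA.
have st0 : 0 <= s + t by rewrite addr_ge0.
have bl (h : E -> R) : bounded_mfun h -> bounded_mfun (fun w => \1_A w * h (X (s + t) w)).
  move=> bh; apply: bounded_mfunM; first exact: bounded_mfun_indic.
  exact: bounded_process.
have br (h : E -> R) : bounded_mfun h ->
    bounded_mfun (fun w => \1_A w * semigroup X Px t h (X s w)).
  move=> bh; apply: bounded_mfunM; first exact: bounded_mfun_indic.
  by apply: bounded_process => //; exact: semigroup_bounded.
apply/eqP; rewrite -subr_eq0; apply/eqP; move: g bg.
have ind w : `|\1_A w : R| <= 1.
  by rewrite indicE; case: (_ \in _); rewrite ?normr1 ?normr0.
apply: (@linear_functional_eq0 _ _ _ _ 2).
- move=> f g bf bg.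
  transitivity (\int[Q]_w (\1_A w * f (X (s + t) w) + \1_A w * g (X (s + t) w)) -
    \int[Q]_w (\1_A w * semigroup X Px t f (X s w) +
               \1_A w * semigroup X Px t g (X s w))).
    congr (_ - _).
      by apply: eq_Rintegral => w _; rewrite mulrDr.
    apply: eq_Rintegral => w _; rewrite -mulrDr; congr (_ * _).
    by rewrite /semigroup expectD//; [exact: prob_kernel|exact: bounded_process..].
  rewrite !expectD//; [lra|exact: br..|exact: bl|exact: bl].
- move=> a f bf.
  transitivity (\int[Q]_w (a * (\1_A w * f (X (s + t) w))) -
    \int[Q]_w (a * (\1_A w * semigroup X Px t f (X s w)))).
    congr (_ - _).
      by apply: eq_Rintegral => w _; rewrite mulrCA.
    apply: eq_Rintegral => w _; rewrite mulrCA; congr (_ * _).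
    by rewrite /semigroup expectZ//; [exact: prob_kernel|exact: bounded_process].
  by rewrite !expectZ//; [rewrite mulrBr|exact: br|exact: bl].
- move=> M f bf fM; rewrite mulrDl mul1r; apply: le_trans (ler_normB _ _) _.
  apply: lerD; (apply: norm_expect_le; [by []|by [exact: bl|exact: br]|move=> w]).
    by rewrite normrM -[leRHS]mul1r ler_pM.
  rewrite normrM -[leRHS]mul1r ler_pM//; exact: norm_semigroup_le.
- move=> B mB.
  have -> : (fun w => \1_A w * \1_B (X (s + t) w)) =
      (\1_(A `&` X (s + t) @^-1` B) : Om -> R).
    by apply/funext => w; rewrite indicI.
  have mXB u : 0 <= u -> measurable (X u @^-1` B).
    by move=> u0; rewrite -[_ @^-1` _]setTI; exact: measurable_process.
  rewrite expect_indic; last by apply: measurableI => //; exact: mXB.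
  rewrite markovQ// integral_mkcond; apply/eqP; rewrite subr_eq0; apply/eqP.
  congr fine; apply: eq_integral => w _; rewrite patchE indicE.
  case: (w \in A); last by rewrite mul0r.
  rewrite mul1r semigroup_indic// fineK//.
  apply: (finite_kernel_measure Px); exact: mXB.
Qed.

Lemma markov_past s t Y (g : E -> R) : 0 <= s -> 0 <= t -> past_bounded X s Y ->
  bounded_mfun g ->
  \int[Q]_w (Y w * g (X (s + t) w)) =
  \int[Q]_w (Y w * semigroup X Px t g (X s w)).
Proof.
move=> s0 t0 pY bg.
have st0 : 0 <= s + t by rewrite addr_ge0.
pose H w := g (X (s + t) w) - semigroup X Px t g (X s w).
have b1 : bounded_mfun (fun w => g (X (s + t) w)) by exact: bounded_process.
have b2 : bounded_mfun (fun w => semigroup X Px t g (X s w)).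
  by apply: bounded_process => //; exact: semigroup_bounded.
have bH : bounded_mfun H by exact: bounded_mfunB.
have bYH Z : past_bounded X s Z -> bounded_mfun (fun w => Z w * H w).
  by move=> /past_bounded_mfun bZ; exact: bounded_mfunM.
have [M M0 HM] := bounded_mfun_pos bH.
suff YH0 : \int[Q]_w (Y w * H w) = 0.
  apply/eqP; rewrite -subr_eq0 -expectB//; last 2 first.
  - by apply: bounded_mfunM => //; exact: past_bounded_mfun pY.
  - by apply: bounded_mfunM => //; exact: past_bounded_mfun pY.
  by rewrite -[X in _ == X]YH0; apply/eqP/eq_Rintegral => w _; rewrite -mulrBr.
move: Y pY; apply: (@linear_functional_eq0 _
  (g_sigma_algebraType (past_events X s)) _ (fun Y => \int[Q]_w (Y w * H w)) M).
- move=> Y Z bY bZ; rewrite -expectD//; [|exact: bYH..].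
  by apply: eq_Rintegral => w _; rewrite mulrDl.
- move=> a Y bY; rewrite -expectZ//; last exact: bYH.
  by apply: eq_Rintegral => w _; rewrite mulrA.
- move=> K Y bY YK; apply: norm_expect_le => //; first exact: bYH.
  by move=> w; rewrite normrM mulrC ler_pM//; exact: YK.
- move=> A mA.
  have mA' := past_measurable mA.
  have := @markov_indic s t A g s0 t0 mA bg => /eqP; rewrite -subr_eq0 -expectB//.
  + move=> /eqP h; rewrite -[RHS]h.
    by apply: eq_Rintegral => w _; rewrite -mulrBr.
  + by apply: bounded_mfunM => //; exact: bounded_mfun_indic.
  + by apply: bounded_mfunM => //; exact: bounded_mfun_indic.
Qed.

End mixture.

Lemma markov_under_start x : markov_under X Px (Px x).
Proof. by have [_ _ M] := markovX; exact: M. Qed.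

Lemma chapman_kolmogorov s t (g : E -> R) : 0 <= s -> 0 <= t -> bounded_mfun g ->
  semigroup X Px (s + t) g = semigroup X Px s (semigroup X Px t g).
Proof.
move=> s0 t0 bg; apply/funext => x; rewrite /semigroup.
have := @markov_past _ (prob_kernel x) (markov_under_start x) s t (fun=> 1) g s0 t0
   (bounded_mfun_cst _ 1) bg.
by under eq_Rintegral do rewrite mul1r; move=> ->; under eq_Rintegral do rewrite mul1r.
Qed.

End markov_property.
(** * The stationary law of the process *)

Section path_law.
Context (R : realType) (dE dO : measure_display).
Context (E : measurableType dE) (Om : measurableType dO).
Variables (Px : R.-pker E ~> Om) (mu : probability E R).

Let law0 : law_from Px mu set0 = 0%E.
Proof. by rewrite /law_from; apply: integral0_eq => x _; rewrite measure0. Qed.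

Let law_ge0 A : (0 <= law_from Px mu A)%E.
Proof. by apply: integral_ge0 => x _; exact: measure_ge0. Qed.

Let law_sigma_additive : semi_sigma_additive (law_from Px mu).
Proof.
move=> U mU tU mUU; rewrite [X in _ --> X](_ : _ =
  \int[mu]_x (\sum_(n <oo) Px x (U n)))%E; last first.
  apply: eq_integral => x _.
  by apply/esym/cvg_lim => //; exact/measure_semi_sigma_additive.
apply/cvg_closeP; split.
  by apply: is_cvg_nneseries => n _ _; exact: integral_ge0.
rewrite closeE// integral_nneseries// => n.
exact: measurable_kernel (mU n).
Qed.

HB.instance Definition _ := isMeasure.Build _ _ R
  (law_from Px mu) law0 law_ge0 law_sigma_additive.

Let law_setT : law_from Px mu setT = 1%E.
Proof.
rewrite /law_from; under eq_integral do rewrite prob_kernel.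
by rewrite integral_cst// mul1e; exact: probability_setT.
Qed.

HB.instance Definition _ := Measure_isProbability.Build _ _ _
  (law_from Px mu) law_setT.

Definition path_law : probability Om R := law_from Px mu.

Lemma expect_path_law (h : Om -> R) : bounded_mfun h ->
  \int[path_law]_w h w = \int[mu]_x \int[Px x]_w h w.
Proof.
have mu1 := @probability_setT _ _ _ mu.
move=> bh; apply/eqP; rewrite -subr_eq0; apply/eqP; move: h bh.
apply: (@linear_functional_eq0 _ _ _ _ 2).
- move=> f g bf bg; rewrite expectD//.
  rewrite [X in _ - X = _](_ : _ = \int[mu]_x \int[Px x]_w f w + \int[mu]_x \int[Px x]_w g w).
    lra.
  rewrite -expectD//; [|exact: kernel_expect_bounded..].
  by apply: eq_Rintegral => x _; rewrite expectD//; exact: prob_kernel.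
- move=> a f bf; rewrite expectZ//.
  rewrite mulrBr; congr (_ - _); rewrite -expectZ//; last exact: kernel_expect_bounded.
  by apply: eq_Rintegral => x _; rewrite expectZ//; exact: prob_kernel.
- move=> M f bf fM; rewrite mulrDl mul1r; apply: le_trans (ler_normB _ _) _.
  apply: lerD; first by exact: norm_expect_le.
  apply: norm_expect_le => //; first exact: kernel_expect_bounded.
  by move=> x; apply: norm_expect_le => //; exact: prob_kernel.
- move=> A mA; rewrite expect_indic//; apply/eqP; rewrite subr_eq0; apply/eqP.
  congr fine; rewrite /path_law/= /law_from; apply: eq_integral => x _.
  by rewrite expect_indic// fineK//; apply: (finite_kernel_measure Px).
Qed.

Variable X : R -> Om -> E.
Hypothesis markovX : markov_process X Px.

Lemma path_law_markov : markov_under X Px path_law.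
Proof.
move=> s t A B s0 t0 pA mB.
have mA := past_measurable markovX pA.
have mXB u : 0 <= u -> measurable (X u @^-1` B).
  by move=> u0; rewrite -[_ @^-1` _]setTI; exact: (measurable_process markovX).
pose h w : R := \1_A w * semigroup X Px t \1_B (X s w).
have bh : bounded_mfun h.
  apply: bounded_mfunM; first exact: bounded_mfun_indic.
  by apply: (bounded_process markovX) => //; apply: (semigroup_bounded markovX) => //; exact: bounded_mfun_indic.
have hE (Q : {measure set Om -> \bar R}) : Q setT = 1%E ->
    (\int[Q]_(w in A) Px (X s w) (X t @^-1` B) = (\int[Q]_w h w)%:E)%E.
  move=> Q1; rewrite EFin_expect// integral_mkcond.
  apply: eq_integral => w _; rewrite patchE /h indicE.
  case: (w \in A); last by rewrite mul0r.
  rewrite mul1r (semigroup_indic markovX)// fineK//.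
  by apply: (finite_kernel_measure Px); exact: mXB.
have mu1 := @probability_setT _ _ _ mu.
rewrite hE // expect_path_law// EFin_expect//; last exact: kernel_expect_bounded.
rewrite /path_law/= /law_from; apply: eq_integral => x _.
by rewrite -hE ?prob_kernel// -(markov_under_start markovX).
Qed.

Hypothesis inv_mu : invariant_measure X Px mu.

Lemma expect_semigroup t (g : E -> R) : 0 <= t -> bounded_mfun g ->
  \int[mu]_x semigroup X Px t g x = \int[mu]_x g x.
Proof.
have mu1 := @probability_setT _ _ _ mu.
move=> t0 bg; apply/eqP; rewrite -subr_eq0; apply/eqP; move: g bg.
apply: (@linear_functional_eq0 _ _ _ _ 2).
- move=> f g bf bg; rewrite [X in _ - X = _]expectD//.
  rewrite [X in X - _ = _](_ : _ = \int[mu]_x semigroup X Px t f x + \int[mu]_x semigroup X Px t g x).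
    lra.
  rewrite -expectD//; [|exact: (semigroup_bounded markovX)..].
  apply: eq_Rintegral => x _; rewrite /semigroup expectD//; [exact: prob_kernel|exact: (bounded_process markovX)..].
- move=> a f bf; rewrite [X in _ - X = _]expectZ//.
  rewrite mulrBr; congr (_ - _); rewrite -expectZ//; last exact: (semigroup_bounded markovX).
  apply: eq_Rintegral => x _; rewrite /semigroup expectZ//; [exact: prob_kernel|exact: (bounded_process markovX)].
- move=> M f bf fM; rewrite mulrDl mul1r; apply: le_trans (ler_normB _ _) _.
  apply: lerD; apply: norm_expect_le => //; first exact: (semigroup_bounded markovX).
  by move=> x; exact: (norm_semigroup_le markovX).
- move=> B mB.
  have -> : \int[mu]_x \1_B x = fine (\int[mu]_x Px x (X t @^-1` B))%E.
    by rewrite inv_mu// expect_indic.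
  apply/eqP; rewrite subr_eq0; apply/eqP.
  congr fine; apply: eq_integral => x _.
  rewrite (semigroup_indic markovX)// fineK//; apply: (finite_kernel_measure Px).
  by rewrite -[_ @^-1` _]setTI; exact: (measurable_process markovX).
Qed.

Lemma expect_stationary t (g : E -> R) : 0 <= t -> bounded_mfun g ->
  \int[path_law]_w g (X t w) = \int[mu]_x g x.
Proof.
move=> t0 bg; rewrite expect_path_law; last exact: (bounded_process markovX).
exact: expect_semigroup.
Qed.

End path_law.

Section supnorm.
Context (R : realType) (T : Type).
Implicit Types f : T -> R.

Lemma supnorm_ge0 f : 0 <= supnorm f.
Proof.
have [hs|/sup_out h] := pselect (has_sup (range (fun x => `|f x|))); last first.
  by rewrite /supnorm h.
have [[_ [x _ _]] ub] := hs.
by apply: le_trans (normr_ge0 (f x)) _; apply: ub_le_sup => //; exists x.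
Qed.

Lemma supnorm_le f K : 0 <= K -> (forall x, `|f x| <= K) -> supnorm f <= K.
Proof.
move=> K0 fK.
have [[ne _]|/sup_out h] := pselect (has_sup (range (fun x => `|f x|))); last first.
  by rewrite /supnorm h.
by apply: ge_sup => // _ [x _ <-].
Qed.

Lemma norm_le_supnorm1 f : supnorm f = 1 -> forall x, `|f x| <= 1.
Proof.
move=> f1 x.
have [[_ ub]|/sup_out h] := pselect (has_sup (range (fun x => `|f x|))); last first.
  by move: f1; rewrite /supnorm h => /esym/eqP; rewrite oner_eq0.
by rewrite -f1; apply: ub_le_sup => //; exists x.
Qed.

End supnorm.
(** * Decay of the semigroup in mean *)

Lemma bounded_mfun_Lfun2 d (T : measurableType d) (R : realType)
    (mu : probability T R) (f : T -> R) :
  bounded_mfun f -> f \in Lfun mu 2%:E.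
Proof.
move=> bf; have [mf _] := bf.
rewrite inE/=; apply/andP; split; rewrite inE//=.
rewrite /finite_norm unlock poweR_lty//.
under eq_integral => x _/= do rewrite powR_mulrn// real_normK ?num_real// expr2.
apply: integrable_lty => //.
exact: (bounded_mfun_integrable (probability_setT mu) (bounded_mfunM bf bf)).
Qed.

Section mixing.
Context (R : realType) (dE dO : measure_display).
Context (E : measurableType dE) (Om : measurableType dO).
Variables (X : R -> Om -> E) (Px : R.-pker E ~> Om) (mu : probability E R).
Hypothesis markovX : markov_process X Px.
Hypothesis inv_mu : invariant_measure X Px mu.
Variables eta alpha : R -> R.
Hypothesis eta_var : forall f : E -> R, measurable_fun [set: E] f ->
  (exists M : R, forall x, `|f x| <= M) ->
  forall t : R, 0 <= t -> variance_under mu (semigroup X Px t f) <=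
    eta t * supnorm (fun x => f x - \int[mu]_y f y) ^+ 2.
Hypothesis alphaE : (forall s : R, 0 <= s -> alpha s = Num.sqrt (eta s)) \/
  (symmetric_measure X Px mu /\ forall s : R, 0 <= s -> alpha s = eta (s / 2)).
Hypothesis alpha_gt0 : forall s, 0 <= s -> 0 < alpha s.

Let mu1 : mu setT = 1%E := probability_setT mu.

Lemma eta_gt0 s : 0 <= s -> 0 < eta s.
Proof.
move=> s0; case: alphaE => [aE|[_ aE]].
  by rewrite -sqrtr_gt0 -aE// alpha_gt0.
have -> : s = (2 * s) / 2 by field.
by rewrite -aE ?alpha_gt0// mulr_ge0.
Qed.

Lemma semigroup_variance t (g : E -> R) M : 0 <= t -> 0 <= M ->
  bounded_mfun g -> (forall x, `|g x| <= M) ->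
  \int[mu]_x (semigroup X Px t g x - \int[mu]_y g y) ^+ 2 <=
    eta t * (2 * M) ^+ 2.
Proof.
move=> t0 M0 bg gM; set m := \int[mu]_y g y.
have bP := semigroup_bounded markovX t0 bg.
have -> : \int[mu]_x (semigroup X Px t g x - m) ^+ 2 =
    variance_under mu (semigroup X Px t g).
  have -> : \int[mu]_x (semigroup X Px t g x - m) ^+ 2 =
      \int[mu]_x ((semigroup X Px t g x * semigroup X Px t g x -
         (2 * m) * semigroup X Px t g x) + m ^+ 2).
    by apply: eq_Rintegral => x _; ring.
  have b2 := bounded_mfunM bP bP.
  have bm := bounded_mfunZ (2 * m) bP.
  rewrite expectD//; [|exact: bounded_mfunB|exact: bounded_mfun_cst].
  rewrite expectB// expectZ// expect_cst// /variance_under.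
  rewrite (expect_semigroup markovX inv_mu)// -/m.
  under [in RHS]eq_Rintegral do rewrite expr2.
  by ring.
have [mg _] := bg; apply: le_trans (eta_var mg _ t0) _; first by exists M.
rewrite ler_pM2l ?eta_gt0//.
rewrite lerXn2r// ?nnegrE ?supnorm_ge0 ?mulr_ge0//.
apply: supnorm_le => [|x]; first by rewrite mulr_ge0.
rewrite mulrDl mul1r (le_trans (ler_normB _ _))// lerD//.
exact: norm_expect_le.
Qed.

(** Both choices of [alpha] bound the semigroup from the uniform norm to
    L^1(mu). For the square root of [eta] this is the Cauchy-Schwarz inequality;
    in the symmetric case half of the time is spent on the sign of
    [P_t g - int g], so that two variances at time [t / 2] are multiplied. *)
Lemma semigroup_L1 t (g : E -> R) M : 0 <= t -> 0 < M ->
  bounded_mfun g -> (forall x, `|g x| <= M) ->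
  \int[mu]_x `|semigroup X Px t g x - \int[mu]_y g y| <= 4 * M * alpha t.
Proof.
move=> t0 M0 bg gM; set m := \int[mu]_y g y.
have bP u (h : E -> R) : 0 <= u -> bounded_mfun h ->
    bounded_mfun (fun x => semigroup X Px u h x - m).
  move=> u0 bh; apply: bounded_mfunB; last exact: bounded_mfun_cst.
  exact: semigroup_bounded.
have a0 := alpha_gt0 t0.
case: alphaE => [aE|[sym aE]].
  have bPt := bP _ _ t0 bg.
  have := semigroup_variance t0 (ltW M0) bg gM; rewrite -/m => varM.
  have eE : eta t = alpha t ^+ 2 by rewrite aE// sqr_sqrtr// ltW// eta_gt0.
  (* [|y| <= y ^ 2 / (2 k) + k / 2], with equality at the expected size [k] of [|y|] *)
  pose k := 2 * M * alpha t.
  have k0 : 0 < k by rewrite !mulr_gt0.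
  apply: (@le_trans _ _ (\int[mu]_x
     ((2 * k)^-1 * (semigroup X Px t g x - m) ^+ 2 + k / 2))).
    have b2 : bounded_mfun (fun x => (semigroup X Px t g x - m) ^+ 2).
      by under eq_fun do rewrite expr2; exact: bounded_mfunM.
    apply: le_expect => //; first exact: bounded_mfun_norm.
      by apply: bounded_mfunD; [exact: bounded_mfunZ|exact: bounded_mfun_cst].
    move=> x; set y := _ - m; rewrite -(real_normK (num_real y)).
    rewrite -subr_ge0; have -> : (2 * k)^-1 * `|y| ^+ 2 + k / 2 - `|y| =
      (2 * k)^-1 * (`|y| - k) ^+ 2 by field; rewrite gt_eqF.
    by rewrite mulr_ge0 ?sqr_ge0// invr_ge0 mulr_ge0// ltW.
  rewrite expectD//; last 2 first.
  - apply: bounded_mfunZ; by under eq_fun do rewrite expr2; exact: bounded_mfunM.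
  - exact: bounded_mfun_cst.
  rewrite expectZ//; last by under eq_fun do rewrite expr2; exact: bounded_mfunM.
  rewrite expect_cst//.
  apply: (@le_trans _ _ ((2 * k)^-1 * (eta t * (2 * M) ^+ 2) + k / 2)).
    by rewrite lerD2r ler_pM2l// invr_gt0 mulr_gt0.
  rewrite eE /k; have -> : (2 * (2 * M * alpha t))^-1 * (alpha t ^+ 2 * (2 * M) ^+ 2) + 2 * M * alpha t / 2
     = 2 * M * alpha t by field; rewrite !gt_eqF.
  by rewrite !ler_pM2r// ler_nat.
have t20 : 0 <= t / 2 by rewrite divr_ge0.
have mphi : measurable_fun setT (fun x => Num.sg (semigroup X Px t g x - m)).
  have [mP _] := bP t g t0 bg.
  have -> : (fun x => Num.sg (semigroup X Px t g x - m)) =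
    (fun x => \1_([set x | 0 < semigroup X Px t g x - m]) x -
       \1_([set x | semigroup X Px t g x - m < 0]) x).
    apply/funext => x; rewrite !indicE; case: sgrP => [h|p|p].
    - by rewrite memNset/= ?h ?ltxx// memNset/= ?h ?ltxx// subr0.
    - by rewrite mem_set// memNset/= ?subr0//; apply/negP; rewrite -leNgt ltW.
    - rewrite memNset/= ?mem_set//= ?sub0r//; apply/negP; rewrite -leNgt ltW//.
  apply: measurable_funB; apply: measurable_indic.
    exact: (measurable_lt_set (measurable_cst _) mP).
  exact: (measurable_lt_set mP (measurable_cst _)).
set phi := fun x => Num.sg (semigroup X Px t g x - m) in mphi.
have phi1 x : `|phi x| <= 1.
  by rewrite /phi normr_sg; case: eqP => //=.
have bphi : bounded_mfun phi by split=> //; exists 1.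
pose h := semigroup X Px (t / 2) g.
have bh : bounded_mfun h by exact: (semigroup_bounded markovX).
pose psi := semigroup X Px (t / 2) phi.
have bpsi : bounded_mfun psi by exact: (semigroup_bounded markovX).
pose n := \int[mu]_y phi y.
have bc := bounded_mfun_cst E.
have e1 : \int[mu]_x `|semigroup X Px t g x - m| =
   \int[mu]_x ((psi x - n) * (h x - m)).
  have -> : \int[mu]_x `|semigroup X Px t g x - m| =
      \int[mu]_x (phi x * semigroup X Px (t / 2) h x - m * phi x).
    apply: eq_Rintegral => x _.
    rewrite /h -(chapman_kolmogorov markovX t20 t20 bg) -splitr.
    by rewrite (mulrC m) -mulrBr normrEsg.
  rewrite expectB//; [|by apply: bounded_mfunM => //; exact: (semigroup_bounded markovX)|exact: bounded_mfunZ].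
  rewrite -(sym (t / 2) phi h t20 (bounded_mfun_Lfun2 mu bphi) (bounded_mfun_Lfun2 mu bh)).
  rewrite expectZ// -/n -/psi.
  have -> : \int[mu]_x ((psi x - n) * (h x - m)) =
    \int[mu]_x (psi x * h x - (m * psi x + n * h x - n * m)).
    by apply: eq_Rintegral => x _; ring.
  have bmn : bounded_mfun (fun x => m * psi x + n * h x).
    by apply: bounded_mfunD; exact: bounded_mfunZ.
  rewrite expectB//; [|exact: bounded_mfunM|exact: bounded_mfunB].
  rewrite expectB// expectD//; [|exact: bounded_mfunZ..].
  rewrite !expectZ// expect_cst// (expect_semigroup markovX inv_mu)//.
  by rewrite (expect_semigroup markovX inv_mu)// -/m -/n; ring.
have bpn : bounded_mfun (fun x => psi x - n) by exact: bounded_mfunB.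
have bhm : bounded_mfun (fun x => h x - m) by exact: bounded_mfunB.
have sq (f : E -> R) : bounded_mfun f -> bounded_mfun (fun x => f x ^+ 2).
  by move=> bf; under eq_fun do rewrite expr2; exact: bounded_mfunM.
(* the weights balance the variances of [psi] and [h], which are at most [4] and
   [4 * M ^ 2] times [eta (t / 2)] *)
rewrite e1; apply: (@le_trans _ _ (\int[mu]_x
   (M / 2 * (psi x - n) ^+ 2 + (2 * M)^-1 * (h x - m) ^+ 2))).
  apply: le_expect => //; first exact: bounded_mfunM.
    by apply: bounded_mfunD; apply: bounded_mfunZ; exact: sq.
  move=> x; rewrite -subr_ge0.
  have -> : M / 2 * (psi x - n) ^+ 2 + (2 * M)^-1 * (h x - m) ^+ 2 -
     (psi x - n) * (h x - m) = (2 * M)^-1 * (M * (psi x - n) - (h x - m)) ^+ 2.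
    by field; rewrite gt_eqF.
  by rewrite mulr_ge0 ?sqr_ge0// invr_ge0 mulr_ge0// ltW.
rewrite expectD//; [|by apply: bounded_mfunZ; exact: sq..].
rewrite !expectZ//; [|exact: sq..].
have v1 := semigroup_variance t20 ler01 bphi phi1.
have v2 := semigroup_variance t20 (ltW M0) bg gM.
apply: (@le_trans _ _ (M / 2 * (eta (t / 2) * (2 * 1) ^+ 2) +
   (2 * M)^-1 * (eta (t / 2) * (2 * M) ^+ 2))).
  by apply: lerD; rewrite ler_pM2l// ?invr_gt0 ?mulr_gt0.
rewrite -aE// le_eqVlt; apply/orP; left; apply/eqP; field; by rewrite gt_eqF.
Qed.

End mixing.
(** * Integrals along the path *)

Definition path_integral (R : realType) (E Om : Type) (X : R -> Om -> E)
    (f : E -> R) (a b : R) (w : Om) : R :=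
  \int[@lebesgue_measure R]_(r in `[a, b]) f (X r w).

Section path_integral.
Context (R : realType) (dE dO : measure_display).
Context (E : measurableType dE) (Om : measurableType dO).
Variable X : R -> Om -> E.
Hypothesis mX : measurable_fun
  ([set q | 0 <= q.1] : set (measurableTypeR R * Om))
  (fun q : measurableTypeR R * Om => X q.1 q.2).
Variable Q : probability Om R.
Variables (f : E -> R) (a b : R).
Hypotheses (bf : bounded_mfun f) (a0 : 0 <= a).

Let G (W : Om -> R) : measurableTypeR R * Om -> R :=
  (fun q => f (X q.1 q.2) * W q.2) \_ (`[a, b] `*` setT).

Let G_integrable W : bounded_mfun W ->
  (@lebesgue_measure R \x Q)%E.-integrable setT (EFin \o G W).
Proof.
move=> [mW [N WN]]; have [mf [M fM]] := bf.
have mD : measurable (`[a, b]%classic `*` setT : set (measurableTypeR R * Om)).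
  exact: measurableX.
have mG : measurable_fun (`[a, b]%classic `*` setT : set (measurableTypeR R * Om))
    (fun q => f (X q.1 q.2) * W q.2).
  apply: measurable_funM.
    apply: (measurable_comp (F := setT)) => //.
    apply: measurable_funS mX => //.
      exact: measurable_nonneg_times.
    by move=> -[u w] /= [+ _]; rewrite in_itv/= => /andP[+ _]; exact: le_trans.
  apply: (measurable_comp (F := setT)) => //.
  exact: measurable_funTS.
rewrite /G -restrict_EFin; apply/integrable_restrict => //; rewrite setTI.
apply: measurable_bounded_integrable => //.
  rewrite [ltLHS](_ : _ = @lebesgue_measure R `[a, b]%classic * Q setT)%E; last first.
    exact: product_measure1E.
  rewrite [X in (_ * X)%E]probability_setT mule1.
  by rewrite /= lebesgue_measure_itv/=; case: ifP => _; rewrite ?ltey.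
exists (M * N); split; first exact: num_real.
move=> x Mx -[u w] _ /=; apply: le_trans (ltW Mx).
by rewrite normrM ler_pM.
Qed.

Let G_section W r w : G W (r, w) = ((fun r => f (X r w) * W w) \_ `[a, b]) r.
Proof.
rewrite /G !patchE; congr (if _ then _ else _).
by apply/idP/idP; rewrite !inE/=; [case|].
Qed.

Lemma path_bounded_integrable w :
  (@lebesgue_measure R).-integrable `[a, b] (EFin \o (fun r => f (X r w))).
Proof.
have [mf [M fM]] := bf.
apply: measurable_bounded_integrable => //.
- by rewrite /= lebesgue_measure_itv/=; case: ifP => _; rewrite ?ltey.
- apply: (measurable_comp (F := setT)) => //.
  apply: (measurable_comp (F := [set q : measurableTypeR R * Om | 0 <= q.1])
    (f := fun q : measurableTypeR R * Om => X q.1 q.2)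
    (g := fun r : measurableTypeR R => (r, w))) => //.
  + exact: measurable_nonneg_times.
  + move=> _ [r rab <-]; move: rab; rewrite /= in_itv/= => /andP[+ _]; exact: le_trans.
  + by apply: measurable_funTS; apply: measurable_fun_pair;
      [exact: measurable_id|exact: measurable_cst].
- exists M; split; first exact: num_real.
  by move=> x Mx r _; apply: le_trans (fM _) (ltW Mx).
Qed.

Let int_G W w : (\int[@lebesgue_measure R]_r (G W (r, w))%:E =
  (path_integral X f a b w * W w)%:E)%E.
Proof.
have iX := path_bounded_integrable w.
have iXW : (@lebesgue_measure R).-integrable `[a, b]
    (EFin \o (fun r => f (X r w) * W w)).
  rewrite (_ : _ \o _ = (fun r => (f (X r w))%:E * (W w)%:E)%E); last first.
    by apply/funext => r; rewrite /= EFinM.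
  exact: integrableZr.
rewrite /path_integral -RintegralZr// /Rintegral fineK; last exact: integrable_fin_num.
rewrite [RHS]integral_mkcond; apply: eq_integral => r _.
by rewrite G_section !patchE; case: ifP.
Qed.

Lemma path_integral_bounded : bounded_mfun (path_integral X f a b).
Proof.
have [mf [M fM]] := bf.
have b1 := bounded_mfun_cst Om (1 : R).
split.
  have -> : path_integral X f a b =
      fine \o fubini_G (@lebesgue_measure R) (EFin \o G (cst 1)).
    by apply/funext => w; rewrite /= /fubini_G/= (int_G (cst 1))/= mulr1.
  apply: measurableT_comp => //; apply: measurable_fubini_G; exact: G_integrable.
exists (M * `|b - a|) => w; rewrite /path_integral.
have ii := path_bounded_integrable w.
apply: le_trans (le_normr_Rintegral _ ii) _ => //.
apply: (@le_trans _ _ (\int[@lebesgue_measure R]_(r in `[a, b]) M)).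
  apply: le_Rintegral => //; first exact: integrable_norm.
  apply: measurable_bounded_integrable => //.
    by rewrite /= lebesgue_measure_itv/=; case: ifP => _; rewrite ?ltey.
  by exists `|M|; split; [exact: num_real|move=> x Mx r _ /=; exact: ltW].
rewrite Rintegral_cst//= lebesgue_measure_itv/=.
have M0 : 0 <= M by apply: le_trans (normr_ge0 _) (fM point).
case: ifP => [|_]; last by rewrite mulr0 mulr_ge0.
by rewrite /= => _; rewrite ler_wpM2l// ler_norm.
Qed.

Lemma expect_path_integral W : bounded_mfun W ->
  (@lebesgue_measure R).-integrable `[a, b]
     (EFin \o (fun r => \int[Q]_w (f (X r w) * W w))) /\
  \int[Q]_w (path_integral X f a b w * W w) =
  \int[@lebesgue_measure R]_(r in `[a, b]) \int[Q]_w (f (X r w) * W w).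
Proof.
move=> bW; have iG := G_integrable bW.
have FE : fubini_F Q (EFin \o G W) = EFin \o
   ((fun r => \int[Q]_w (f (X r w) * W w)) \_ `[a, b]).
  apply/funext => r; rewrite /fubini_F/=.
  under eq_integral do rewrite G_section patchE.
  rewrite patchE; case: ifPn => rab; last by rewrite integral0.
  have r0 : 0 <= r.
    by move: rab; rewrite inE/= in_itv/= => /andP[+ _]; exact: le_trans.
  have bfX : bounded_mfun (fun w => f (X r w)).
    have [mf [M fM]] := bf; split; last by exists M.
    by apply: measurableT_comp => //; exact: joint_measurable_section.
  by rewrite EFin_expect//; [exact: probability_setT|exact: bounded_mfunM].
split.
  have := integrable_fubini_F iG; rewrite FE -restrict_EFin.
  by move/integrable_restrict; rewrite setTI; apply.
rewrite [in RHS]Rintegral_mkcond {2}/Rintegral.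
have -> : (\int[@lebesgue_measure R]_r (((fun r => \int[Q]_w (f (X r w) * W w)) \_ `[a, b]) r)%:E
   = \int[@lebesgue_measure R]_r fubini_F Q (EFin \o G W) r)%E.
  by rewrite FE.
rewrite fubini1// -fubini2//; congr fine; apply: eq_integral => w _.
by rewrite /fubini_G/= int_G.
Qed.

End path_integral.
(** * Approximation of Lipschitz functions by polynomials *)

Section bernstein.
Context {R : realType}.
Implicit Types (phi psi : R -> R) (x a h c L : R).

(** Bernstein's operator as an average over [n] Bernoulli([x]) steps of size [h]
    started at [a]. The recursion on steps makes positivity and the second
    moment immediate, and shows that the result is a polynomial in [x]. *)
Fixpoint bernstein phi h (n : nat) x a : R :=
  if n is n'.+1 then
    (1 - x) * bernstein phi h n' x a + x * bernstein phi h n' x (a + h)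
  else phi a.

Lemma bernstein_second_moment h c n x a :
  bernstein (fun z => (z - c) ^+ 2) h n x a =
  (a + n%:R * h * x - c) ^+ 2 + n%:R * h ^+ 2 * (x * (1 - x)).
Proof.
elim: n a => [|n IHn] a /=; first by rewrite !mul0r !addr0.
rewrite !IHn -natr1; ring.
Qed.

Lemma bernstein_affine psi h (k l : R) n x a :
  bernstein (fun z => k + l * psi z) h n x a = k + l * bernstein psi h n x a.
Proof. by elim: n a => [//|n IHn] a /=; rewrite !IHn; ring. Qed.

Lemma bernstein_le phi psi h n x a : 0 <= x <= 1 ->
  (forall z, phi z <= psi z) -> bernstein phi h n x a <= bernstein psi h n x a.
Proof.
move=> /andP[x0 x1] le; elim: n a => [|n IHn] a //=.
by apply: lerD; apply: ler_wpM2l; rewrite ?subr_ge0.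
Qed.

Lemma bernstein_lipschitz_close phi L h n x a d : 0 <= x <= 1 -> 0 <= L -> 0 < d ->
  (forall y z, `|phi y - phi z| <= L * `|y - z|) ->
  `|bernstein phi h n x a - phi (a + n%:R * h * x)| <=
    L * (d + d^-1 * (n%:R * h ^+ 2)).
Proof.
move=> x01 L0 d0 phiL; set c := a + n%:R * h * x.
have /andP[x0 x1] := x01.
have lin z : `|z - c| <= d + d^-1 * (z - c) ^+ 2.
  rewrite -(real_normK (num_real (z - c))); set y := `|z - c|.
  rewrite -subr_ge0; have -> : d + d^-1 * y ^+ 2 - y =
     d^-1 * ((y - d / 2) ^+ 2 + 3 / 4 * d ^+ 2) by field; rewrite gt_eqF.
  by rewrite mulr_ge0 ?invr_ge0 ?(ltW d0)// addr_ge0 ?sqr_ge0// mulr_ge0 ?sqr_ge0.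
have mom : bernstein (fun z => d + d^-1 * (z - c) ^+ 2) h n x a <=
    d + d^-1 * (n%:R * h ^+ 2).
  rewrite bernstein_affine lerD2l ler_pM2l ?invr_gt0// bernstein_second_moment.
  rewrite subrr expr0n/= add0r -[leRHS]mulr1; apply: ler_wpM2l.
    by rewrite mulr_ge0 ?sqr_ge0.
  by apply: mulr_ile1 => //; rewrite ?subr_ge0// lerBlDr lerDl.
have up : bernstein phi h n x a <=
    phi c + L * bernstein (fun z => d + d^-1 * (z - c) ^+ 2) h n x a.
  rewrite -bernstein_affine; apply: bernstein_le => // z.
  rewrite -lerBlDl (le_trans (ler_norm _))// (le_trans (phiL _ _))//.
  exact: ler_wpM2l.
have lo : phi c + (- L) * bernstein (fun z => d + d^-1 * (z - c) ^+ 2) h n x a <=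
    bernstein phi h n x a.
  rewrite -bernstein_affine; apply: bernstein_le => // z.
  rewrite mulNr lerBlDl -lerBlDr (le_trans (ler_norm _))//.
  by rewrite distrC (le_trans (phiL _ _))//; exact: ler_wpM2l.
have mom' := ler_wpM2l L0 mom.
by rewrite ler_norml; apply/andP; split; lra.
Qed.

(** A family of functions that contains the constants and is closed under linear
    combinations and under multiplication by a bounded [S] contains the
    polynomials in [S]; its uniform closure thus contains the Lipschitz
    functions of [S]. *)
Lemma lipschitz_uniform_closure (T : Type) (C : (T -> R) -> Prop) (S : T -> R) M :
  0 < M -> (forall w, `|S w| <= M) ->
  (forall k, C (fun=> k)) ->
  (forall f g, C f -> C g -> C (fun w => f w + g w)) ->
  (forall k f, C f -> C (fun w => k * f w)) ->
  (forall f, C f -> C (fun w => S w * f w)) ->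
  forall phi L e, 0 <= L -> (forall y z, `|phi y - phi z| <= L * `|y - z|) ->
    0 < e -> exists2 f, C f & forall w, `|phi (S w) - f w| <= e.
Proof.
move=> M0 SM Cc CD CZ CS phi L e L0 phiL e0.
pose x w := (S w + M) / (2 * M).
have CB h n a : C (fun w => bernstein phi h n (x w) a).
  elim: n a => [|n IHn] a /=; first exact: Cc.
  have -> : (fun w => (1 - x w) * bernstein phi h n (x w) a +
       x w * bernstein phi h n (x w) (a + h)) = (fun w =>
     (2^-1 * bernstein phi h n (x w) a +
      (- (2 * M)^-1) * (S w * bernstein phi h n (x w) a)) +
     (2^-1 * bernstein phi h n (x w) (a + h) +
      (2 * M)^-1 * (S w * bernstein phi h n (x w) (a + h)))).
    by apply/funext => w; rewrite /x; field; rewrite gt_eqF.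
  by apply: (CD); apply: (CD); apply: (CZ) => //; exact: CS.
pose d := e / (2 * (L + 1)).
have d0 : 0 < d by rewrite divr_gt0// mulr_gt0// ltr_wpDl.
pose n := (Num.trunc ((2 * M) ^+ 2 / d ^+ 2)).+1.
have n0 : 0 < n%:R :> R by rewrite ltr0n.
exists (fun w => bernstein phi (2 * M / n%:R) n (x w) (- M)); first exact: CB.
move=> w; have x01 : 0 <= x w <= 1.
  have := SM w; rewrite ler_norml => /andP[s1 s2].
  rewrite /x divr_ge0 ?mulr_ge0 ?(ltW M0)//=; last by rewrite -lerBlDr sub0r.
  by rewrite ler_pdivrMr ?mulr_gt0// mul1r mulrDl mul1r lerD2r.
have := bernstein_lipschitz_close (2 * M / n%:R) n (- M) x01 L0 d0 phiL.
have -> : - M + n%:R * (2 * M / n%:R) * x w = S w.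
  by rewrite /x; field; rewrite !gt_eqF.
rewrite distrC => /le_trans; apply.
have hn : d^-1 * (n%:R * (2 * M / n%:R) ^+ 2) <= d.
  have -> : d^-1 * (n%:R * (2 * M / n%:R) ^+ 2) = (2 * M) ^+ 2 / d ^+ 2 * d / n%:R.
    by field; rewrite !gt_eqF.
  rewrite ler_pdivrMr// mulrC ler_pM2l// ltW// Num.Theory.truncnS_gt//.
apply: (@le_trans _ _ (L * (d + d))); first by rewrite ler_wpM2l// lerD2l.
have -> : L * (d + d) = e * (L / (L + 1)) by rewrite /d; field; rewrite gt_eqF// ltr_wpDl.
by rewrite -[leRHS]mulr1 ler_pM2l// ler_pdivrMr ?ltr_wpDl// mul1r lerDl.
Qed.

Lemma lipschitz_continuous_fun phi L : 0 <= L ->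
  (forall y z, `|phi y - phi z| <= L * `|y - z|) -> continuous phi.
Proof.
move=> L0 phiL y; apply/cvgrPdist_le => e e0.
have L1 : 0 < L + 1 by rewrite ltr_wpDl.
have : \forall z \near y, `|y - z| < e / (L + 1).
  have /cvgrPdist_lt/(_ (e / (L + 1))) : z @[z --> y] --> y by exact: cvg_id.
  by apply; rewrite divr_gt0.
apply: filterS => z yz; apply: le_trans (phiL _ _) _.
apply: (@le_trans _ _ ((L + 1) * `|y - z|)); first by rewrite ler_wpM2r// lerDl.
by rewrite mulrC -ler_pdivlMr// ltW.
Qed.

End bernstein.
(** * Decorrelation of the path integral from the future *)

Section path_functionals.
Context (R : realType) (dE dO : measure_display).
Context (E : measurableType dE) (Om : measurableType dO).
Variables (X : R -> Om -> E) (Px : R.-pker E ~> Om) (mu : probability E R).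
Hypothesis markovX : markov_process X Px.
Hypothesis inv_mu : invariant_measure X Px mu.
Variables (f : E -> R) (D : R).
Hypotheses (bf : bounded_mfun f) (D0 : 0 < D) (fD : forall x, `|f x| <= D).
Hypothesis f_centered : \int[mu]_x f x = 0.
Variable alpha : R -> R.
Hypothesis alpha_noninc : forall s t, 0 <= s -> s <= t -> alpha t <= alpha s.
Hypothesis L1_alpha : forall t (g : E -> R) M, 0 <= t -> 0 < M ->
  bounded_mfun g -> (forall x, `|g x| <= M) ->
  \int[mu]_x `|semigroup X Px t g x - \int[mu]_y g y| <= 4 * M * alpha t.

Let P := path_law Px mu.
Let S s := path_integral X f 0 s.

Let mX : measurable_fun ([set q | 0 <= q.1] : set (measurableTypeR R * Om))
  (fun q : measurableTypeR R * Om => X q.1 q.2).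
Proof. by have [] := markovX. Qed.

Let P1 : P setT = 1%E. Proof. exact: probability_setT. Qed.
Let mu1 : mu setT = 1%E. Proof. exact: probability_setT. Qed.

Let bX t (g : E -> R) : 0 <= t -> bounded_mfun g ->
  bounded_mfun (fun w => g (X t w)).
Proof. exact: (bounded_process markovX). Qed.

Let bU a b : 0 <= a -> bounded_mfun (path_integral X f a b).
Proof. by move=> a0; apply: (path_integral_bounded mX P). Qed.

Let bphi (phi : R -> R) L s : 0 <= L ->
  (forall y z, `|phi y - phi z| <= L * `|y - z|) -> bounded_mfun (fun w => phi (S s w)).
Proof.
move=> L0 phiL; apply: bounded_mfun_comp.
- exact: lipschitz_continuous_fun L0 phiL.
- exact: bU.
have [M M0 SM] := bounded_mfun_pos (bU s (lexx 0)).
exists (`|phi 0| + L * M) => w; rewrite -[phi _](subrK (phi 0)) addrC.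
apply: le_trans (ler_normD _ _) _; rewrite lerD2l (le_trans (phiL _ _))// subr0.
exact: ler_wpM2l.
Qed.

(** The Markov property at time [u] for functionals that involve the integral
    [S s], [s <= u]. Joint measurability of the process does not make [S s]
    measurable with respect to the past; but by Fubini the random variables [W]
    that satisfy the identity against every past [Y] are stable under
    multiplication by [S s], and so include its Lipschitz functions. *)
Lemma markov_functional phi L s u v Y (g : E -> R) :
  0 <= s -> s <= u -> 0 <= v -> 0 <= L ->
  (forall y z, `|phi y - phi z| <= L * `|y - z|) ->
  past_bounded X u Y -> bounded_mfun g ->
  \int[P]_w (phi (S s w) * (Y w * g (X (u + v) w))) =
  \int[P]_w (phi (S s w) * (Y w * semigroup X Px v g (X u w))).
Proof.
move=> s0 su v0 L0 phiL pY bg.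
have u0 : 0 <= u by exact: le_trans su.
have bPg : bounded_mfun (fun w => semigroup X Px v g (X u w)).
  by apply: bX => //; exact: semigroup_bounded.
have bgX : bounded_mfun (fun w => g (X (u + v) w)) by apply: bX; rewrite ?addr_ge0.
pose H w := g (X (u + v) w) - semigroup X Px v g (X u w).
have bH : bounded_mfun H by exact: bounded_mfunB.
pose C W := bounded_mfun W /\
  forall Y, past_bounded X u Y -> \int[P]_w (W w * (Y w * H w)) = 0.
have bYH Z : past_bounded X u Z -> bounded_mfun (fun w => Z w * H w).
  by move=> /(past_bounded_mfun markovX) bZ; exact: bounded_mfunM.
have CH Z : past_bounded X u Z -> \int[P]_w (Z w * H w) = 0.
  move=> pZ; have bZ := past_bounded_mfun markovX pZ.
  rewrite /H; under eq_Rintegral do rewrite mulrBr.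
  rewrite expectB//; [|exact: bounded_mfunM..].
  have := markov_past markovX P1 (path_law_markov mu markovX) u0 v0 pZ bg.
  by move=> ->; rewrite subrr.
have Cc k : C (fun=> k).
  split => [|Z pZ]; first exact: bounded_mfun_cst.
  by rewrite expectZ//; [rewrite CH ?mulr0|exact: bYH].
have CD W W' : C W -> C W' -> C (fun w => W w + W' w).
  move=> [bW W0] [bW' W'0]; split => [|Z pZ]; first exact: bounded_mfunD.
  under eq_Rintegral do rewrite mulrDl.
  by rewrite expectD ?W0 ?W'0 ?addr0//; apply: bounded_mfunM => //; exact: bYH.
have CZ k W : C W -> C (fun w => k * W w).
  move=> [bW W0]; split => [|Z pZ]; first exact: bounded_mfunZ.
  under eq_Rintegral do rewrite -mulrA.
  by rewrite expectZ ?W0 ?mulr0//; apply: bounded_mfunM => //; exact: bYH.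
have CS W : C W -> C (fun w => S s w * W w).
  move=> [bW W0]; split => [|Z pZ]; first by apply: bounded_mfunM => //; exact: bU.
  have bWZH : bounded_mfun (fun w => W w * (Z w * H w)).
    by apply: bounded_mfunM => //; exact: bYH.
  under eq_Rintegral do rewrite -mulrA.
  have [_ ->] := expect_path_integral mX P s bf (lexx 0) bWZH.
  rewrite -[RHS](mul0r (fine (@lebesgue_measure R `[0, s]%classic))) -Rintegral_cst//.
  apply: eq_Rintegral => r; rewrite inE/= in_itv/= => /andP[r0 rs].
  rewrite -(W0 (fun w => f (X r w) * Z w)).
    by apply: eq_Rintegral => w _; rewrite mulrCA -mulrA.
  have pf : past_bounded X u (fun w => f (X r w)).
    by apply: past_bounded_process => //; rewrite r0 (le_trans rs).
  exact: (bounded_mfunM pf pZ).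
have [M M0 SM] := bounded_mfun_pos (bU s (lexx 0)).
have bphiS := bphi s L0 phiL.
have bY := past_bounded_mfun markovX pY.
apply/eqP; rewrite -subr_eq0 -expectB//; last 2 first.
- by apply: bounded_mfunM => //; exact: bounded_mfunM.
- by apply: bounded_mfunM => //; exact: bounded_mfunM.
have -> : \int[P]_w (phi (S s w) * (Y w * g (X (u + v) w)) -
   phi (S s w) * (Y w * semigroup X Px v g (X u w))) =
   \int[P]_w (phi (S s w) * (Y w * H w)).
  by apply: eq_Rintegral => w _; rewrite /H; ring.
have [K K0 YHK] := bounded_mfun_pos (bYH _ pY).
rewrite -normr_eq0 eq_le normr_ge0 andbT; apply/ler_addgt0Pr => e e0; rewrite add0r.
have eK0 : 0 < e / K by rewrite divr_gt0.
have [W [bW W0] We] := lipschitz_uniform_closure M0 SM Cc CD CZ CS L0 phiL eK0.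
have -> : \int[P]_w (phi (S s w) * (Y w * H w)) =
    \int[P]_w ((phi (S s w) - W w) * (Y w * H w)).
  under [RHS]eq_Rintegral do rewrite mulrBl.
  rewrite expectB ?W0 ?subr0//; apply: bounded_mfunM => //; exact: bYH.
apply: norm_expect_le => [//||w].
  by apply: bounded_mfunM; [exact: bounded_mfunB|exact: bYH].
rewrite normrM; have -> : e = (e / K) * K by field; rewrite gt_eqF.
by apply: ler_pM.
Qed.

(** The Markov property turns [g (X (s + v))] into [semigroup v g (X s)], which is
    close to [\int[mu] g] in L^1 by stationarity: only the uniform norm of
    [phi (S s)] is paid. *)
Lemma decorrelate phi L K s v (g : E -> R) M : 0 <= s -> 0 <= v -> 0 <= L -> 0 <= K ->
  (forall y z, `|phi y - phi z| <= L * `|y - z|) ->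
  (forall w, `|phi (S s w)| <= K) ->
  0 < M -> bounded_mfun g -> (forall x, `|g x| <= M) ->
  `|\int[P]_w (phi (S s w) * g (X (s + v) w)) -
    (\int[P]_w phi (S s w)) * \int[mu]_x g x| <= K * (4 * M * alpha v).
Proof.
move=> s0 v0 L0 K0 phiL phiK M0 bg gM; set m := \int[mu]_x g x.
have bphiS := bphi s L0 phiL.
have bPg : bounded_mfun (semigroup X Px v g) by exact: semigroup_bounded.
have bPgm : bounded_mfun (fun x => semigroup X Px v g x - m).
  by apply: bounded_mfunB => //; exact: bounded_mfun_cst.
have p1 : past_bounded X s (fun _ : Om => 1 : R) by exact: bounded_mfun_cst.
have -> : \int[P]_w (phi (S s w) * g (X (s + v) w)) =
    \int[P]_w (phi (S s w) * semigroup X Px v g (X s w)).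
  have := markov_functional s0 (lexx s) v0 L0 phiL p1 bg.
  under eq_Rintegral do rewrite mul1r; move=> ->.
  by apply: eq_Rintegral => w _; rewrite mul1r.
rewrite (mulrC _ m) -expectZ// -expectB//; last 2 first.
- by apply: bounded_mfunM => //; exact: bX.
- exact: bounded_mfunZ.
have -> : \int[P]_w (phi (S s w) * semigroup X Px v g (X s w) - m * phi (S s w)) =
    \int[P]_w (phi (S s w) * (semigroup X Px v g (X s w) - m)).
  by apply: eq_Rintegral => w _; rewrite mulrBr (mulrC m).
apply: (le_trans (le_norm_expect P1 _)).
  by apply: bounded_mfunM => //; exact: (bX (g := fun x => semigroup X Px v g x - m)).
apply: (@le_trans _ _ (\int[P]_w (K * `|semigroup X Px v g (X s w) - m|))).
  have bn : bounded_mfun (fun w => `|semigroup X Px v g (X s w) - m|).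
    exact: (bX (g := fun x => `|semigroup X Px v g x - m|) s0 (bounded_mfun_norm bPgm)).
  apply: le_expect => //; last by move=> w; rewrite normrM ler_wpM2r.
    apply: bounded_mfun_norm; apply: bounded_mfunM => //.
    exact: (bX (g := fun x => semigroup X Px v g x - m)).
  exact: bounded_mfunZ.
have bn := bounded_mfun_norm bPgm.
rewrite expectZ//; last exact: (bX (g := fun x => `|semigroup X Px v g x - m|)).
rewrite ler_wpM2l//.
rewrite (expect_stationary markovX inv_mu s0 bn).
exact: L1_alpha.
Qed.

(** Two factors: the Markov property at time [r] replaces the pair by the single
    function [f * semigroup (r' - r) f], whose mean is small by mixing over
    [r' - r], and which is then decorrelated from [phi (S s)] over [r - s]. The main
    term keeps the factor [E phi (S s)] instead of a uniform bound. *)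
Lemma decorrelate_pair phi L s v r r' : 0 <= s -> 0 <= v -> 0 <= L ->
  (forall y z, `|phi y - phi z| <= L * `|y - z|) ->
  (forall y, 0 <= phi y <= 1) -> s + v <= r -> s + v <= r' ->
  \int[P]_w (phi (S s w) * (f (X r w) * f (X r' w))) <=
    (\int[P]_w phi (S s w)) * (4 * D ^+ 2 * alpha `|r' - r|) + 4 * D ^+ 2 * alpha v.
Proof.
move=> s0 v0 L0 phiL phi01.
wlog rr' : r r' / r <= r'.
  move=> wl; have [rr'|/ltW rr'] := leP r r'; first exact: wl.
  move=> svr svr'; rewrite distrC.
  under eq_Rintegral do rewrite (mulrC (f (X r _))).
  exact: wl.
move=> svr _; rewrite ger0_norm ?subr_ge0//.
have r0 : 0 <= r by apply: le_trans svr; rewrite addr_ge0.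
have d0 : 0 <= r' - r by rewrite subr_ge0.
pose d := r' - r; pose h x := f x * semigroup X Px d f x.
have bPf : bounded_mfun (semigroup X Px d f) by exact: semigroup_bounded.
have bh : bounded_mfun h by exact: bounded_mfunM.
have hD x : `|h x| <= D ^+ 2.
  by rewrite normrM expr2 ler_pM//; exact: (norm_semigroup_le markovX).
have D20 : 0 < D ^+ 2 by rewrite exprn_gt0.
have pf : past_bounded X r (fun w => f (X r w)).
  by apply: past_bounded_process => //; rewrite r0 lexx.
have sr : s <= r by apply: le_trans svr; rewrite lerDl.
have -> : r' = r + d by rewrite /d addrC subrK.
rewrite (markov_functional s0 sr d0 L0 phiL pf bf).
have svE : s + (r - s) = r by rewrite addrC subrK.
have vr : v <= r - s by rewrite lerBrDl.
have phi1 w : `|phi (S s w)| <= 1.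
  by have /andP[p0 p1] := phi01 (S s w); rewrite ger0_norm.
have := decorrelate s0 (le_trans v0 vr) L0 ler01 phiL phi1 D20 bh hD.
rewrite svE mul1r -/h => /(le_trans (ler_norm _)); rewrite lerBlDl => /le_trans; apply.
apply: lerD; last first.
  by apply: ler_wpM2l; [rewrite mulr_ge0// ltW|exact: alpha_noninc].
rewrite ler_wpM2l//; first by apply: expect_ge0 => w; case/andP: (phi01 (S s w)).
rewrite addrC addKr.
apply: (@le_trans _ _ (\int[mu]_x (D * `|semigroup X Px d f x - \int[mu]_y f y|))).
  have bn : bounded_mfun (fun x => `|semigroup X Px d f x - \int[mu]_y f y|).
    by apply: bounded_mfun_norm; apply: bounded_mfunB => //; exact: bounded_mfun_cst.
  apply: le_expect => //; first exact: bounded_mfunZ.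
  move=> x; rewrite f_centered subr0 /h (le_trans (ler_norm _))// normrM.
  by rewrite ler_wpM2r.
rewrite expectZ//; last first.
  by apply: bounded_mfun_norm; apply: bounded_mfunB => //; exact: bounded_mfun_cst.
have -> : 4 * D ^+ 2 * alpha d = D * (4 * D * alpha d) by ring.
by rewrite ler_wpM2l ?(ltW D0)//; exact: L1_alpha.
Qed.

Let integrable_cst (a b k : R) : (@lebesgue_measure R).-integrable `[a, b] (EFin \o cst k).
Proof.
apply: measurable_bounded_integrable => //.
  by rewrite /= lebesgue_measure_itv/=; case: ifP => _; rewrite ?ltey.
by exists `|k|; split; [exact: num_real|move=> x Mx r _ /=; exact: ltW].
Qed.

Let Rintegral_itv_cst (a b k : R) : a <= b ->
  \int[@lebesgue_measure R]_(r in `[a, b]) k = k * (b - a).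
Proof.
move=> ab; rewrite Rintegral_cst//= lebesgue_measure_itv/= lte_fin.
by case: ltgtP ab => //= -> _; rewrite subrr.
Qed.

Lemma decorrelate_block phi L K s v a b : 0 <= s -> 0 <= v -> 0 <= L -> 0 <= K ->
  (forall y z, `|phi y - phi z| <= L * `|y - z|) ->
  (forall w, `|phi (S s w)| <= K) -> s + v <= a -> a <= b ->
  \int[P]_w (phi (S s w) * path_integral X f a b w) <= K * (4 * D * alpha v) * (b - a).
Proof.
move=> s0 v0 L0 K0 phiL phiK sva ab.
have a0 : 0 <= a by apply: le_trans sva; rewrite addr_ge0.
under eq_Rintegral do rewrite mulrC.
have [ii ->] := expect_path_integral mX P b bf a0 (bphi s L0 phiL).
rewrite -Rintegral_itv_cst//; apply: le_Rintegral => //; first exact: integrable_cst.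
move=> r; rewrite /= in_itv/= => /andP[ar rb].
under eq_Rintegral do rewrite mulrC.
have vr : v <= r - s by rewrite lerBrDl (le_trans sva).
have := decorrelate s0 (le_trans v0 vr) L0 K0 phiL phiK D0 bf fD.
rewrite f_centered mulr0 subr0 (addrC s) subrK => /(le_trans (ler_norm _)) /le_trans; apply.
rewrite !ler_wpM2l//; last exact: alpha_noninc.
by rewrite mulr_ge0// ltW.
Qed.

(** The covariance of the process is summable along [beta], hence the second
    moment of the integral over a block is proportional to the length of the block,
    up to a decorrelation error. *)
Lemma block_second_moment phi L s v a b (beta : R -> R) A :
  0 <= s -> 0 <= v -> 0 <= L ->
  (forall y z, `|phi y - phi z| <= L * `|y - z|) ->
  (forall y, 0 <= phi y <= 1) -> s + v <= a -> a <= b ->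
  (forall x, alpha `|x| <= beta x) ->
  (forall r, (@lebesgue_measure R).-integrable `[a, b] (EFin \o (fun r' => beta (r' - r)))) ->
  (forall r, \int[@lebesgue_measure R]_(r' in `[a, b]) beta (r' - r) <= A) ->
  \int[P]_w (phi (S s w) * path_integral X f a b w ^+ 2) <=
    (\int[P]_w phi (S s w)) * (4 * D ^+ 2 * (b - a) * A) +
    4 * D ^+ 2 * (b - a) ^+ 2 * alpha v.
Proof.
move=> s0 v0 L0 phiL phi01 sva ab alphabeta ibeta betaA.
have a0 : 0 <= a by apply: le_trans sva; rewrite addr_ge0.
have bphiS := bphi s L0 phiL.
have bUab := bU b a0.
set U := path_integral X f a b; set p := \int[P]_w phi (S s w).
have p0 : 0 <= p by apply: expect_ge0 => w; case/andP: (phi01 (S s w)).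
have D40 : 0 <= 4 * D ^+ 2 by rewrite mulr_ge0 ?sqr_ge0.
have -> : \int[P]_w (phi (S s w) * U w ^+ 2) = \int[P]_w (U w * (U w * phi (S s w))).
  by apply: eq_Rintegral => w _; ring.
have [ii ->] := expect_path_integral mX P b bf a0 (bounded_mfunM bUab bphiS).
have -> : p * (4 * D ^+ 2 * (b - a) * A) + 4 * D ^+ 2 * (b - a) ^+ 2 * alpha v =
  (p * (4 * D ^+ 2 * A) + 4 * D ^+ 2 * (b - a) * alpha v) * (b - a) by ring.
rewrite -Rintegral_itv_cst//; apply: le_Rintegral => //; first exact: integrable_cst.
move=> r; rewrite /= in_itv/= => /andP[ar rb].
have r0 : 0 <= r by exact: le_trans ar.
have bfphi : bounded_mfun (fun w => f (X r w) * phi (S s w)).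
  by apply: bounded_mfunM => //; exact: bX.
under eq_Rintegral do rewrite mulrCA.
have [ii' ->] := expect_path_integral mX P b bf a0 bfphi.
have ib : (@lebesgue_measure R).-integrable `[a, b]
    (EFin \o (fun r' => p * (4 * D ^+ 2) * beta (r' - r))).
  rewrite (_ : _ \o _ = (fun r' => (p * (4 * D ^+ 2))%R%:E * (beta (r' - r)%R)%:E)%E); last first.
    by apply/funext => r'; rewrite /= EFinM.
  exact: integrableZl (ibeta r).
apply: (@le_trans _ _ (\int[@lebesgue_measure R]_(r' in `[a, b])
   (p * (4 * D ^+ 2) * beta (r' - r) + 4 * D ^+ 2 * alpha v))).
  apply: le_Rintegral => //.
    rewrite (_ : _ \o _ = (fun r' => (p * (4 * D ^+ 2) * beta (r' - r))%R%:E +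
       (EFin \o cst (4 * D ^+ 2 * alpha v)%R) r')%E); last first.
      by apply/funext => r'; rewrite /= EFinD.
    by apply: integrableD => //; exact: integrable_cst.
  move=> r'; rewrite /= in_itv/= => /andP[ar' r'b].
  have -> : \int[P]_w (f (X r' w) * (f (X r w) * phi (S s w))) =
     \int[P]_w (phi (S s w) * (f (X r w) * f (X r' w))).
    by apply: eq_Rintegral => w _; ring.
  apply: le_trans (decorrelate_pair s0 v0 L0 phiL phi01 (le_trans sva ar) (le_trans sva ar')) _.
  by rewrite lerD2r -/p mulrA ler_wpM2l// mulr_ge0.
rewrite RintegralD//; last exact: integrable_cst.
rewrite [X in X + _ <= _]RintegralZl//.
rewrite [X in _ + X <= _]Rintegral_itv_cst//.
have -> : 4 * D ^+ 2 * (b - a) * alpha v = 4 * D ^+ 2 * alpha v * (b - a) by ring.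
by rewrite lerD2r (mulrA p (4 * D ^+ 2) A) ler_wpM2l// mulr_ge0.
Qed.

End path_functionals.
(** * The test function *)

Section test_function.
Context {R : realType}.
Implicit Types y z d m : R.

(** Exponential on the left and quadratic on the right of 0. The exponential part
    carries the deviation probability; beyond 0 the second derivative stays
    bounded by 1, so that the errors made by decorrelation, which are only small in
    L^1, are never multiplied by an exponential. *)
Definition expquad y : R :=
  expR (Num.min y 0) + Num.max y 0 + Num.max y 0 ^+ 2 / 2.

Definition expquad' y : R := expR (Num.min y 0) + Num.max y 0.

Definition expquad'' y : R := expR (Num.min y 0).

Let minmax_neg y : y <= 0 -> Num.min y 0 = y /\ Num.max y 0 = 0.
Proof. by move=> y0; rewrite min_l// max_r. Qed.

Let minmax_pos y : 0 <= y -> Num.min y 0 = 0 /\ Num.max y 0 = y.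
Proof. by move=> y0; rewrite min_r// max_l. Qed.

Lemma expquad_neg y : y <= 0 -> expquad y = expR y.
Proof. by move=> /minmax_neg[e1 e2]; rewrite /expquad e1 e2 expr0n/= mul0r !addr0. Qed.

Lemma expquad_pos y : 0 <= y -> expquad y = 1 + y + y ^+ 2 / 2.
Proof. by move=> /minmax_pos[e1 e2]; rewrite /expquad e1 e2 expR0. Qed.

Lemma expquad'_neg y : y <= 0 -> expquad' y = expR y.
Proof. by move=> /minmax_neg[e1 e2]; rewrite /expquad' e1 e2 addr0. Qed.

Lemma expquad'_pos y : 0 <= y -> expquad' y = 1 + y.
Proof. by move=> /minmax_pos[e1 e2]; rewrite /expquad' e1 e2 expR0. Qed.

Lemma expquad''_neg y : y <= 0 -> expquad'' y = expR y.
Proof. by move=> /minmax_neg[e1 _]; rewrite /expquad'' e1. Qed.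

Lemma expquad''_pos y : 0 <= y -> expquad'' y = 1.
Proof. by move=> /minmax_pos[e1 _]; rewrite /expquad'' e1 expR0. Qed.

Let expR_tangent y z : expR z * (1 + (y - z)) <= expR y.
Proof.
have -> : y = z + (y - z) by rewrite addrC subrK.
by rewrite expRD addrAC subrr add0r ler_wpM2l ?expR_ge0 ?expR_ge1Dx.
Qed.

Lemma expquad_convex y z : expquad z + expquad' z * (y - z) <= expquad y.
Proof.
have [z0|z0] := leP z 0; have [y0|y0] := leP y 0.
- rewrite !expquad_neg// expquad'_neg//.
  by have := expR_tangent y z; rewrite mulrDr mulr1.
- rewrite expquad_neg// expquad'_neg// (expquad_pos (ltW y0)).
  have := expR_tangent 0 z; rewrite expR0 => t0.
  have ez1 : expR z <= 1 by rewrite -expR0 ler_expR.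
  have : expR z * y <= 1 * y by rewrite ler_wpM2r// ltW.
  have := sqr_ge0 y; move: t0; nra.
- rewrite (expquad_pos (ltW z0)) (expquad'_pos (ltW z0)) expquad_neg//.
  have := expR_ge1Dx y; have : z * y <= 0 by rewrite mulr_ge0_le0// ltW.
  have := sqr_ge0 z; nra.
- rewrite (expquad_pos (ltW z0)) (expquad'_pos (ltW z0)) (expquad_pos (ltW y0)).
  have := sqr_ge0 (y - z); nra.
Qed.

Lemma expquad''_gt0 y : 0 < expquad'' y.
Proof. exact: expR_gt0. Qed.

Lemma expquad''_le1 y : expquad'' y <= 1.
Proof. by rewrite /expquad'' -expR0 ler_expR ge_min lexx orbT. Qed.

Lemma expquad''_homo y z : y <= z -> expquad'' y <= expquad'' z.
Proof. by move=> yz; rewrite /expquad'' ler_expR le_min !ge_min yz lexx/= orbT. Qed.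

Lemma expquad'_variation y z : y <= z ->
  0 <= expquad' z - expquad' y <= (z - y) * expquad'' z.
Proof.
move=> yz; have yz0 : 0 <= z - y by rewrite subr_ge0.
have [z0|z0] := leP z 0.
  have y0 := le_trans yz z0.
  rewrite !expquad'_neg// expquad''_neg// subr_ge0 ler_expR yz/=.
  have := expR_tangent y z; nra.
rewrite (expquad'_pos (ltW z0)) (expquad''_pos (ltW z0)) mulr1.
have [y0|/ltW y0] := leP y 0; last by rewrite (expquad'_pos y0); apply/andP; split; lra.
rewrite expquad'_neg//; have := expR_ge1Dx y.
have : expR y <= 1 by rewrite -expR0 ler_expR.
by move=> h1 h2; apply/andP; split; lra.
Qed.

Lemma expquad'_norm_variation y z m : y <= m -> z <= m ->
  `|expquad' z - expquad' y| <= `|z - y| * expquad'' m.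
Proof.
wlog yz : y z / y <= z.
  move=> wl ym zm; have [yz|/ltW zy] := leP y z; first exact: wl.
  by rewrite distrC (distrC z); exact: wl.
move=> _ zm; have /andP[h1 h2] := expquad'_variation yz.
have zy0 : 0 <= z - y by rewrite subr_ge0.
rewrite (ger0_norm h1) (ger0_norm zy0); apply: le_trans h2 _.
by rewrite ler_wpM2l ?subr_ge0//; exact: expquad''_homo.
Qed.

Lemma expquad'_lipschitz y z : `|expquad' y - expquad' z| <= `|y - z|.
Proof.
apply: le_trans (expquad'_norm_variation (m := Num.max y z) _ _) _.
- by rewrite le_max lexx orbT.
- by rewrite le_max lexx.
- by rewrite -[leRHS]mulr1 ler_wpM2l// expquad''_le1.
Qed.

Lemma expquad''_lipschitz y z : `|expquad'' y - expquad'' z| <= `|y - z|.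
Proof.
wlog zy : y z / z <= y.
  move=> wl; have [zy|/ltW zy] := leP z y; first exact: wl.
  by rewrite distrC (distrC y); exact: wl.
rewrite (@ger0_norm _ (_ - _)) ?subr_ge0 ?expquad''_homo//.
rewrite (@ger0_norm _ (y - z)) ?subr_ge0//.
have [y0|y0] := leP y 0.
  have := expquad'_variation zy; have z0 := le_trans zy y0.
  rewrite !expquad'_neg// !expquad''_neg// => /andP[_ /le_trans]; apply.
  by rewrite -[leRHS]mulr1 ler_wpM2l ?subr_ge0// -expR0 ler_expR.
rewrite (expquad''_pos (ltW y0)); have [z0|/ltW z0] := leP z 0; last first.
  by rewrite expquad''_pos// subrr subr_ge0.
by rewrite expquad''_neg//; have := expR_ge1Dx z; lra.
Qed.

Lemma expquad''_shift y d : 0 <= d -> expquad'' (y + d) <= expR d * expquad y.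
Proof.
move=> d0; have [y0|/ltW y0] := leP y 0.
  rewrite expquad_neg// -expRD addrC /expquad'' ler_expR.
  by rewrite ge_min lexx.
apply: le_trans (expquad''_le1 _) _; rewrite expquad_pos// -[leLHS]mulr1.
have d1 : 1 <= expR d by rewrite -expR0 ler_expR.
by apply: ler_pM => //; rewrite -addrA lerDl addr_ge0 ?divr_ge0 ?sqr_ge0.
Qed.

Lemma expquad_ge0 y : 0 <= expquad y.
Proof.
rewrite /expquad !addr_ge0 ?expR_ge0 ?divr_ge0 ?sqr_ge0// le_max lexx orbT//.
Qed.

Lemma expquad_homo y z : y <= z -> expquad y <= expquad z.
Proof.
move=> yz; apply: le_trans (expquad_convex z y); rewrite lerDl.
rewrite mulr_ge0 ?subr_ge0// /expquad' addr_ge0 ?expR_ge0// le_max lexx orbT//.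
Qed.

Lemma measurable_expquad : measurable_fun [set: R] expquad.
Proof.
have mmin : measurable_fun [set: R] (fun y : R => Num.min y 0).
  by apply: measurable_minr.
have mmax : measurable_fun [set: R] (fun y : R => Num.max y 0).
  by apply: measurable_maxr.
apply: measurable_funD; last first.
  apply: measurable_funM; last exact: measurable_cst.
  exact: measurable_funX.
by apply: measurable_funD => //; apply: measurableT_comp => //; exact: measurable_expR.
Qed.

(** Second order expansion of [expquad] over a step [d2], with the first order
    term taken one step [d1] earlier and the second order term frozen two steps
    earlier, at [y]: each factor is then separated from the next increment by a
    full block. *)
Lemma expquad_two_steps y d d1 d2 m : `|d| <= m -> `|d1| <= m -> `|d2| <= m ->
  expquad (y + d + d1 + d2) <= expquad (y + d + d1) + expquad' (y + d) * d2 +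
    expquad'' (y + 3 * m) * (d1 ^+ 2 / 2 + 3 / 2 * d2 ^+ 2).
Proof.
move=> dm d1m d2m.
have /andP[d_ d'] : - m <= d <= m by rewrite -ler_norml.
have /andP[d1_ d1'] : - m <= d1 <= m by rewrite -ler_norml.
have /andP[d2_ d2'] : - m <= d2 <= m by rewrite -ler_norml.
set q := expquad'' (y + 3 * m); have q0 : 0 < q := expquad''_gt0 _.
set x0 := y + d; set x1 := x0 + d1; set x2 := x1 + d2.
have C := expquad_convex x1 x2.
have V1 : `|expquad' x2 - expquad' x1| <= `|d2| * q.
  have -> : d2 = x2 - x1 by rewrite /x2 addrAC subrr add0r.
  by apply: expquad'_norm_variation; rewrite /x2 /x1 /x0; lra.
have V2 : `|expquad' x1 - expquad' x0| <= `|d1| * q.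
  have -> : d1 = x1 - x0 by rewrite /x1 addrAC subrr add0r.
  by apply: expquad'_norm_variation; rewrite /x2 /x1 /x0; lra.
have W1 : (expquad' x2 - expquad' x1) * d2 <= q * d2 ^+ 2.
  apply: le_trans (ler_norm _) _; rewrite normrM.
  apply: le_trans (ler_wpM2r (normr_ge0 _) V1) _.
  by rewrite mulrAC -expr2 real_normK ?num_real// mulrC.
have W2 : (expquad' x1 - expquad' x0) * d2 <= q * (d1 ^+ 2 / 2 + d2 ^+ 2 / 2).
  apply: le_trans (ler_norm _) _; rewrite normrM.
  apply: le_trans (ler_wpM2r (normr_ge0 _) V2) _.
  rewrite mulrAC mulrC ler_wpM2l ?(ltW q0)//.
  rewrite -(real_normK (num_real d1)) -(real_normK (num_real d2)).
  have := sqr_ge0 (`|d1| - `|d2|); nra.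
have E : x1 - x2 = - d2 by rewrite /x2 opprD addrA subrr add0r.
move: C; rewrite E; lra.
Qed.

End test_function.
(** * Recursion over blocks of time *)

Section path_integral_additivity.
Context (R : realType) (dE dO : measure_display).
Context (E : measurableType dE) (Om : measurableType dO).
Variable X : R -> Om -> E.
Hypothesis mX : measurable_fun
  ([set q | 0 <= q.1] : set (measurableTypeR R * Om))
  (fun q : measurableTypeR R * Om => X q.1 q.2).
Variable f : E -> R.
Hypothesis bf : bounded_mfun f.

Lemma path_integralD a b c w : 0 <= a -> a <= b -> b <= c ->
  path_integral X f a c w = path_integral X f a b w + path_integral X f b c w.
Proof.
move=> a0 ab bc; have iac := path_bounded_integrable mX c bf a0 w.
have ibc := path_bounded_integrable mX c bf (le_trans a0 ab) w.
have := Rintegral_itvB iac => /(_ b); rewrite !bnd_simp => /(_ ab bc).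
rewrite Rintegral_itv_obnd_cbnd; last first.
  by apply: integrableS ibc => //; apply: subset_itvr; rewrite bnd_simp.
by rewrite /path_integral => <-; rewrite addrC subrK.
Qed.

Lemma norm_path_integral_le D a b w : (forall x, `|f x| <= D) -> 0 <= a -> a <= b ->
  `|path_integral X f a b w| <= D * (b - a).
Proof.
move=> fD a0 ab; rewrite /path_integral.
have ii := path_bounded_integrable mX b bf a0 w.
apply: le_trans (le_normr_Rintegral _ ii) _ => //.
have -> : D * (b - a) = \int[@lebesgue_measure R]_(r in `[a, b]) D.
  rewrite Rintegral_cst//= lebesgue_measure_itv/= lte_fin.
  by case: ltgtP ab => //= -> _; rewrite subrr.
apply: le_Rintegral => //; first exact: integrable_norm.
apply: measurable_bounded_integrable => //.
  by rewrite /= lebesgue_measure_itv/=; case: ifP => _; rewrite ?ltey.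
by exists `|D|; split; [exact: num_real|move=> x Mx r _ /=; exact: ltW].
Qed.

End path_integral_additivity.

(** Decorrelation costs two blocks, hence the growth term refers to two indices
    before the current one; the majorant is nondecreasing, so the delay is
    harmless. *)
Lemma delayed_gronwall (R : realType) (A : nat -> R) (A0 eps kappa : R) :
  0 <= A0 -> 0 <= eps -> 0 <= kappa ->
  A 0%N <= A0 -> A 1%N <= A0 -> A 2%N <= A0 ->
  forall n, (forall j, (j < n)%N -> A j.+3 <= A j.+2 + eps + kappa * A j) ->
  A n <= (A0 + n%:R * eps) * (1 + kappa) ^+ n.
Proof.
move=> A00 e0 k0 a0 a1 a2 n rec.
pose B n := (A0 + n%:R * eps) * (1 + kappa) ^+ n.
have k1 : 1 <= 1 + kappa by rewrite lerDl.
have B0 m : 0 <= B m by rewrite mulr_ge0 ?addr_ge0 ?mulr_ge0 ?exprn_ge0 ?addr_ge0.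
have BS m : B m + kappa * B m + eps <= B m.+1.
  rewrite /B exprS -natr1.
  have p1 : 1 <= (1 + kappa) ^+ m by exact: exprn_ege1.
  have -> : (A0 + (m%:R + 1) * eps) * ((1 + kappa) * (1 + kappa) ^+ m) =
     (A0 + m%:R * eps) * (1 + kappa) ^+ m + kappa * ((A0 + m%:R * eps) * (1 + kappa) ^+ m)
       + eps * ((1 + kappa) * (1 + kappa) ^+ m) by ring.
  rewrite lerD2l -[leLHS]mulr1 ler_wpM2l//.
  by rewrite -[leLHS]mulr1 ler_pM.
have Bm m : B m <= B m.+1.
  apply: le_trans (BS m); rewrite -addrA lerDl; apply: addr_ge0 => //.
  exact: mulr_ge0.
have A0B m : A0 <= B m.
  elim: m => [|m IH]; first by rewrite /B mul0r addr0 mulr1.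
  exact: le_trans IH (Bm m).
suff H : forall m, (m <= n)%N ->
    [/\ A m <= B m, A m.+1 <= B m.+1 & A m.+2 <= B m.+2].
  by have [] := H n (leqnn n).
elim=> [_|m IH mn].
  by split; [exact: le_trans a0 (A0B _)|exact: le_trans a1 (A0B _)|exact: le_trans a2 (A0B _)].
have [h0 h1 h2] := IH (ltnW mn).
split => //; apply: le_trans (rec m mn) _; apply: le_trans (BS _).
rewrite addrAC lerD2r lerD// ler_wpM2l//.
apply: le_trans h0 _; exact: le_trans (Bm _) (Bm _).
Qed.

Section block_deviation.
Context (R : realType) (dE dO : measure_display).
Context (E : measurableType dE) (Om : measurableType dO).
Variables (X : R -> Om -> E) (Px : R.-pker E ~> Om) (mu : probability E R).
Hypothesis markovX : markov_process X Px.
Hypothesis inv_mu : invariant_measure X Px mu.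
Variables (f : E -> R) (D : R).
Hypotheses (bf : bounded_mfun f) (D0 : 0 < D) (fD : forall x, `|f x| <= D).
Hypothesis f_centered : \int[mu]_x f x = 0.
Variable alpha : R -> R.
Hypothesis alpha_ge0 : forall s, 0 <= s -> 0 <= alpha s.
Hypothesis alpha_noninc : forall s t, 0 <= s -> s <= t -> alpha t <= alpha s.
Hypothesis L1_alpha : forall t (g : E -> R) M, 0 <= t -> 0 < M ->
  bounded_mfun g -> (forall x, `|g x| <= M) ->
  \int[mu]_x `|semigroup X Px t g x - \int[mu]_y g y| <= 4 * M * alpha t.
Variables (beta : R -> R) (A : R).
Hypothesis alpha_beta : forall x, alpha `|x| <= beta x.
Hypothesis beta_integrable : forall a b r, 
  (@lebesgue_measure R).-integrable `[a, b] (EFin \o (fun r' => beta (r' - r))).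
Hypothesis beta_int : forall a b r, a <= b ->
  \int[@lebesgue_measure R]_(r' in `[a, b]) beta (r' - r) <= A.
Variables (l lam x0 : R) (n : nat).
Hypotheses (l0 : 0 < l) (lam0 : 0 < lam) (x00 : 0 <= x0).

Let P := path_law Px mu.
Let S (k : nat) := path_integral X f 0 (k%:R * l).
Let U (k : nat) := path_integral X f (k%:R * l) (k.+1%:R * l).
Let m := D * lam * l.
Let y (k : nat) w := lam * (S k w - x0).
Let K := 1 + lam * D * (n%:R * l).

Let mX : measurable_fun ([set q | 0 <= q.1] : set (measurableTypeR R * Om))
  (fun q : measurableTypeR R * Om => X q.1 q.2).
Proof. by have [] := markovX. Qed.

Let P1 : P setT = 1%E. Proof. exact: probability_setT. Qed.

Let l_ge0 : 0 <= l := ltW l0.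
Let lam_ge0 : 0 <= lam := ltW lam0.
Let D_ge0 : 0 <= D := ltW D0.

Let m0 : 0 <= m. Proof. by rewrite /m !mulr_ge0. Qed.

Let kl0 k : 0 <= k%:R * l. Proof. by rewrite mulr_ge0. Qed.

Let klS k : k%:R * l <= k.+1%:R * l.
Proof. by rewrite ler_pM2r// ler_nat. Qed.

Let SS k w : S k.+1 w = S k w + U k w.
Proof. exact: path_integralD. Qed.

Let yS k w : y k.+1 w = y k w + lam * U k w.
Proof. by rewrite /y SS; ring. Qed.

Let U_le k w : `|lam * U k w| <= m.
Proof.
rewrite normrM gtr0_norm// (_ : m = lam * (D * l)); last by rewrite /m; ring.
rewrite ler_pM2l//.
apply: le_trans (norm_path_integral_le mX bf w fD _ _) _ => //.
by rewrite -mulrBl -natrB// subSnn mul1r.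
Qed.

Let S_le k w : `|S k w| <= D * (k%:R * l).
Proof.
by apply: le_trans (norm_path_integral_le mX bf w fD _ _) _; rewrite ?subr0.
Qed.

Let bS k : bounded_mfun (S k).
Proof. by apply: (path_integral_bounded mX P). Qed.

Let bUk k : bounded_mfun (U k).
Proof. by apply: (path_integral_bounded mX P). Qed.

Let y_le k w : y k w <= lam * (D * (k%:R * l)).
Proof.
rewrite ler_pM2l//; apply: le_trans (S_le k w).
by apply: le_trans (ler_norm _); rewrite gerBl.
Qed.

Let by_ k : bounded_mfun (y k).
Proof. by apply: bounded_mfunZ; apply: bounded_mfunB => //; exact: bounded_mfun_cst. Qed.

Let bF k : bounded_mfun (fun w => expquad (y k w)).
Proof.
split; first by apply: measurableT_comp; [exact: measurable_expquad|case: (by_ k)].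
exists (expquad (lam * (D * (k%:R * l)))) => w.
by rewrite ger0_norm ?expquad_ge0//; apply: expquad_homo.
Qed.

Let phi1 x := expquad' (lam * (x - x0)).
Let phi2 x := expquad'' (lam * (x - x0) + 3 * m).

Let phi1_lip x z : `|phi1 x - phi1 z| <= lam * `|x - z|.
Proof.
apply: le_trans (expquad'_lipschitz _ _) _.
by rewrite -mulrBr opprB addrA subrK normrM gtr0_norm.
Qed.

Let phi2_lip x z : `|phi2 x - phi2 z| <= lam * `|x - z|.
Proof.
apply: le_trans (expquad''_lipschitz _ _) _.
have -> : lam * (x - x0) + 3 * m - (lam * (z - x0) + 3 * m) = lam * (x - z) by ring.
by rewrite normrM gtr0_norm.
Qed.

Let phi2_01 x : 0 <= phi2 x <= 1.
Proof. by rewrite ltW ?expquad''_gt0//= expquad''_le1. Qed.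

Let K_ge1 : 1 <= K.
Proof. by rewrite /K lerDl !mulr_ge0. Qed.

Let phi1_le k w : (k <= n)%N -> `|phi1 (S k w)| <= K.
Proof.
move=> kn; rewrite ger0_norm; last first.
  by rewrite /phi1 /expquad' addr_ge0 ?expR_ge0// le_max lexx orbT.
rewrite /phi1 /K -/(y k w) /expquad' lerD//.
  by rewrite -expR0 ler_expR ge_min lexx orbT.
rewrite ge_max; apply/andP; split; last by rewrite !mulr_ge0//.
apply: le_trans (y_le k w) _; rewrite mulrA ler_wpM2l ?mulr_ge0//.
by rewrite ler_pM2r// ler_nat.
Qed.

Definition block_error : R :=
  lam * (K * (4 * D * alpha l) * l) + 8 * D ^+ 2 * lam ^+ 2 * l ^+ 2 * alpha l.

Definition block_growth : R :=
  8 * D ^+ 2 * lam ^+ 2 * l * A * expR (3 * m).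

Let A_ge0 : 0 <= A.
Proof.
apply: le_trans (beta_int 0 (lexx (0:R))).
apply: Rintegral_ge0 => r _; apply: le_trans (alpha_beta _); exact: alpha_ge0.
Qed.

Let step j : (j < n)%N ->
  \int[P]_w expquad (y j.+3 w) <=
  \int[P]_w expquad (y j.+2 w) + block_error +
    block_growth * \int[P]_w expquad (y j w).
Proof.
move=> jn.
have bp1 : bounded_mfun (fun w => phi1 (S j.+1 w)).
  apply: bounded_mfun_comp => //; last by exists K => w; exact: phi1_le.
  exact: lipschitz_continuous_fun (ltW lam0) phi1_lip.
have bp2 : bounded_mfun (fun w => phi2 (S j w)).
  apply: bounded_mfun_comp => //; last first.
    by exists 1 => w; have /andP[h1 h2] := phi2_01 (S j w); rewrite ger0_norm.
  exact: lipschitz_continuous_fun (ltW lam0) phi2_lip.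
have sq k : bounded_mfun (fun w => U k w ^+ 2).
  by under eq_fun do rewrite expr2; exact: bounded_mfunM.
pose p := \int[P]_w phi2 (S j w).
have pF : p <= expR (3 * m) * \int[P]_w expquad (y j w).
  rewrite -expectZ//; apply: le_expect => //; first exact: bounded_mfunZ.
  by move=> w; apply: expquad''_shift; rewrite mulr_ge0.
have lS k : k%:R * l + l = k.+1%:R * l by rewrite -natr1 mulrDl mul1r.
have lB k : k.+1%:R * l - k%:R * l = l by rewrite -lS addrAC subrr add0r.
have T1 : \int[P]_w (phi1 (S j.+1 w) * U j.+2 w) <= K * (4 * D * alpha l) * l.
  have /= := decorrelate_block markovX inv_mu bf D0 fD f_centered alpha_noninc L1_alpha
    (phi := phi1) (L := lam) (K := K) (s := j.+1%:R * l) (v := l)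
    (a := j.+2%:R * l) (b := j.+3%:R * l) (kl0 _) (ltW l0) (ltW lam0) (le_trans ler01 K_ge1)
    phi1_lip (fun w => phi1_le w jn).
  by rewrite lS lexx lB; apply.
have T2 k : (j < k)%N -> \int[P]_w (phi2 (S j w) * U k w ^+ 2) <=
    p * (4 * D ^+ 2 * l * A) + 4 * D ^+ 2 * l ^+ 2 * alpha l.
  move=> jk.
  have /= := block_second_moment markovX inv_mu bf D0 fD f_centered alpha_noninc L1_alpha
    (phi := phi2) (L := lam) (s := j%:R * l) (v := l)
    (a := k%:R * l) (b := k.+1%:R * l) (kl0 _) (ltW l0) (ltW lam0)
    phi2_lip phi2_01 _ (klS k) alpha_beta (beta_integrable _ _)
    (fun r => beta_int r (klS k)).
  by rewrite lS ler_pM2r// ler_nat lB; apply.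
apply: (@le_trans _ _ (\int[P]_w ((expquad (y j.+2 w) +
    lam * (phi1 (S j.+1 w) * U j.+2 w)) +
    (lam ^+ 2 / 2 * (phi2 (S j w) * U j.+1 w ^+ 2) +
     3 / 2 * lam ^+ 2 * (phi2 (S j w) * U j.+2 w ^+ 2))))).
  apply: le_expect => //.
    apply: bounded_mfunD; apply: bounded_mfunD => //; apply: bounded_mfunZ;
      exact: bounded_mfunM.
  move=> w; rewrite (yS j.+2) (yS j.+1) (yS j).
  apply: le_trans (expquad_two_steps (y j w) (U_le j w) (U_le j.+1 w) (U_le j.+2 w)) _.
  rewrite le_eqVlt; apply/orP; left; apply/eqP.
  rewrite -yS /phi1 /phi2 -/(y j.+1 w) -/(y j w); ring.
rewrite expectD//; last 2 first.
- by apply: bounded_mfunD => //; apply: bounded_mfunZ; exact: bounded_mfunM.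
- by apply: bounded_mfunD; apply: bounded_mfunZ; exact: bounded_mfunM.
rewrite expectD//; last by apply: bounded_mfunZ; exact: bounded_mfunM.
rewrite [X in _ + X <= _]expectD//; [|by apply: bounded_mfunZ; exact: bounded_mfunM..].
rewrite !expectZ//; [|exact: bounded_mfunM..].
have t1 := ler_wpM2l (ltW lam0) T1.
have l20 : 0 <= lam ^+ 2 by rewrite sqr_ge0.
have t2 : lam ^+ 2 / 2 * \int[P]_w (phi2 (S j w) * U j.+1 w ^+ 2) <=
   lam ^+ 2 / 2 * (p * (4 * D ^+ 2 * l * A) + 4 * D ^+ 2 * l ^+ 2 * alpha l).
  by rewrite ler_wpM2l ?divr_ge0// T2.
have t3 : 3 / 2 * lam ^+ 2 * \int[P]_w (phi2 (S j w) * U j.+2 w ^+ 2) <=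
   3 / 2 * lam ^+ 2 * (p * (4 * D ^+ 2 * l * A) + 4 * D ^+ 2 * l ^+ 2 * alpha l).
  by rewrite ler_wpM2l ?mulr_ge0// T2.
have t4 : 8 * D ^+ 2 * lam ^+ 2 * l * A * p <= block_growth * \int[P]_w expquad (y j w).
  rewrite /block_growth -[leRHS]mulrA ler_wpM2l//.
  by rewrite !mulr_ge0 ?exprn_ge0//.
have t23 := lerD t2 t3.
have rhsE : lam ^+ 2 / 2 * (p * (4 * D ^+ 2 * l * A) + 4 * D ^+ 2 * l ^+ 2 * alpha l) +
   3 / 2 * lam ^+ 2 * (p * (4 * D ^+ 2 * l * A) + 4 * D ^+ 2 * l ^+ 2 * alpha l) =
   8 * D ^+ 2 * lam ^+ 2 * l ^+ 2 * alpha l + 8 * D ^+ 2 * lam ^+ 2 * l * A * p.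
  by field.
rewrite /block_error -!addrA lerD2l lerD//.
by apply: le_trans t23 _; rewrite rhsE lerD2l.
Qed.

(** Markov's inequality for [expquad], whose mean grows by a factor
    [1 + block_growth] and an additive [block_error] at each block. *)
Lemma block_deviation h : 2 * m <= lam * x0 -> x0 <= h ->
  fine (P [set w | h <= path_integral X f 0 (n%:R * l) w]) *
    (lam * (h - x0)) ^+ 2 / 2 <=
  (expR (2 * m - lam * x0) + n%:R * block_error) * expR (n%:R * block_growth).
Proof.
move=> mx0 x0h.
have e0 : 0 <= block_error.
  rewrite /block_error addr_ge0// !mulr_ge0 ?exprn_ge0 ?alpha_ge0//.
  exact: le_trans ler01 K_ge1.
have g0 : 0 <= block_growth.
  by rewrite /block_growth !mulr_ge0 ?exprn_ge0 ?expR_ge0.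
(* before two blocks have elapsed there is no room for decorrelation, and the
   deterministic bound of [S k w] by [D * 2 * l] is used *)
have init k : (k <= 2)%N -> \int[P]_w expquad (y k w) <= expR (2 * m - lam * x0).
  move=> k2; have neg : 2 * m - lam * x0 <= 0 by rewrite subr_le0.
  rewrite -(expquad_neg neg) -[leRHS](expect_cst P1).
  apply: le_expect => //; first exact: bounded_mfun_cst.
  move=> w; apply: expquad_homo; rewrite /y mulrBr lerD2r.
  rewrite (_ : 2 * m = lam * (D * (2 * l))); last by rewrite /m; ring.
  rewrite ler_pM2l//; apply: le_trans (ler_norm _) _; apply: le_trans (S_le _ _) _.
  by rewrite ler_pM2l// ler_pM2r// ler_nat.
pose a k := \int[P]_w expquad (y k w).
have grow : a n <= (expR (2 * m - lam * x0) + n%:R * block_error) * (1 + block_growth) ^+ n.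
  by apply: delayed_gronwall => //; rewrite ?expR_ge0 ?init.
have e1 : (1 + block_growth) ^+ n <= expR (n%:R * block_growth).
  rewrite mulrC -[X in expR (_ * X)]/(n%:R) expRM_natr lerXn2r ?nnegrE ?expR_ge0 ?addr_ge0//.
  exact: expR_ge1Dx.
apply: (@le_trans _ _ (a n)); last first.
  apply: le_trans grow _; rewrite ler_wpM2l// addr_ge0 ?expR_ge0 ?mulr_ge0//.
set B := [set w | _].
have mB : measurable B.
  by apply: measurable_le_set => //; case: (bS n).
have xh : 0 <= lam * (h - x0) by rewrite mulr_ge0 ?subr_ge0//.
rewrite -expect_indic// -mulrA (mulrC _ (_ / 2)) -expectZ//; last exact: bounded_mfun_indic.
apply: le_expect => //; first by apply: bounded_mfunZ; exact: bounded_mfun_indic.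
move=> w; rewrite indicE; have [wB|wB] := boolP (w \in B); last by rewrite mulr0 expquad_ge0.
rewrite mulr1; move: wB; rewrite inE /B/= => wB.
apply: (@le_trans _ _ (expquad (lam * (h - x0)))).
  by rewrite expquad_pos// lerDr addr_ge0.
by apply: expquad_homo; rewrite /y ler_pM2l// lerD2r.
Qed.

End block_deviation.
(** * The mixing rate and the choice of the parameters *)

Section cauchy_kernel.
Context {R : realType}.
Variables (k tau : R).
Hypotheses (k0 : 0 <= k) (tau0 : 0 < tau).

(** An integrable majorant of the mixing rate whose integrals over intervals
    centred anywhere are explicit. *)
Definition cauchy_kernel (x : R) : R := k * (1 + (x / tau) ^+ 2)^-1.

Let F (r0 r : R) : R := k * tau * atan ((r - r0) / tau).

Let dF (r0 r : R) : is_derive r 1 (F r0) (cauchy_kernel (r - r0)).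
Proof.
rewrite /F /cauchy_kernel.
have h : is_derive r 1 (fun r : R => (r - r0) * tau^-1) tau^-1.
  have -> : (fun r : R => (r - r0) * tau^-1) = (id \- cst r0) * cst tau^-1 :> (R -> R) by [].
  apply: is_derive_eq; rewrite scaler0 add0r subr0 /GRing.scale/=; exact: mulr1.
have h2 := @is_derive1_comp _ atan (fun r : R => (r - r0) * tau^-1) r _ _
  (is_derive1_atan ((r - r0) / tau)) h.
have -> : (fun r : R => k * tau * atan ((r - r0) / tau)) =
   (k * tau) *: (atan \o (fun r : R => (r - r0) * tau^-1)) :> (R -> R) by [].
apply: is_derive_eq; rewrite /GRing.scale/=.
by set q := (1 + _)^-1; field; rewrite gt_eqF.
Qed.

Let continuous_kernel r0 : continuous (fun r => cauchy_kernel (r - r0)).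
Proof.
move=> r; apply: cvgM; first exact: cvg_cst.
apply: (@continuous_comp _ _ _ (fun r : R => (r - r0) / tau) (fun y : R => (1 + y ^+ 2)^-1)).
  apply: cvgM; last exact: cvg_cst.
  by apply: cvgB; [exact: cvg_id|exact: cvg_cst].
exact: continuous_oneDsqrV.
Qed.

Lemma cauchy_kernel_integrable a b r0 :
  (@lebesgue_measure R).-integrable `[a, b] (EFin \o (fun r => cauchy_kernel (r - r0))).
Proof.
apply: continuous_compact_integrable; first exact: segment_compact.
exact/continuous_subspaceT/continuous_kernel.
Qed.

Lemma cauchy_kernel_int a b r0 : a <= b ->
  \int[@lebesgue_measure R]_(r in `[a, b]) cauchy_kernel (r - r0) <= k * tau * pi.
Proof.
have kt : 0 <= k * tau by rewrite mulr_ge0// ltW.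
rewrite le_eqVlt => /predU1P[<-|ab].
  by rewrite set_itv1 Rintegral_set1 mulr_ge0// pi_ge0.
rewrite /Rintegral (@continuous_FTC2 _ _ (F r0) a b ab).
- rewrite /= /F -mulrBr ler_wpM2l//.
  have := atan_gtNpi2 ((a - r0) / tau); have := atan_ltpi2 ((b - r0) / tau).
  lra.
- exact/continuous_subspaceT/continuous_kernel.
- have cF r : {for r, continuous (F r0)}.
    by apply: differentiable_continuous; apply/derivable1_diffP; case: (dF r0 r).
  split.
  + by move=> r _; case: (dF r0 r).
  + exact: cvg_at_right_filter (cF a).
  + exact: cvg_at_left_filter (cF b).
- by move=> r _; rewrite derive1E; case: (dF r0 r).
Qed.

End cauchy_kernel.
Section rate.
Context {R : realType}.
Variables (b tau : R).
Hypotheses (b1 : 1 <= b) (tau0 : 0 < tau).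

Let b0 : 0 < b. Proof. exact: lt_le_trans b1. Qed.

Lemma rate_le_cauchy s : 0 <= s ->
  expR (- (b * (s / tau) `^ b^-1)) <= 2 * (1 + (s / tau) ^+ 2)^-1.
Proof.
move=> s0; set w := (s / tau) `^ b^-1.
have st0 : 0 <= s / tau by rewrite divr_ge0// ltW.
have w0 : 0 <= w by exact: powR_ge0.
have sE : s / tau = w `^ b by rewrite /w -powRrM mulVf ?gt_eqF// powRr1.
(* [w <= expR (w / 2)] because [expR x >= 2 * x] *)
have we : w ^+ 2 <= expR w.
  have -> : expR w = expR (w / 2) ^+ 2 by rewrite expr2 -expRD -splitr.
  rewrite lerXn2r ?nnegrE ?expR_ge0//.
  have := expR_ge1Dx (w / 2 - 1); rewrite expRD => h.
  have e2 : expR (-1) <= 2^-1 :> R.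
    rewrite expRN lef_pV2 ?posrE ?expR_gt0//.
    by have := expR_ge1Dx (1 : R); lra.
  have : expR (w / 2) * expR (-1) <= expR (w / 2) * 2^-1.
    by rewrite ler_wpM2l ?expR_ge0.
  lra.
have q0 : 0 < 1 + (s / tau) ^+ 2 by rewrite ltr_pwDl ?sqr_ge0.
rewrite -[leRHS]/(_ / _) ler_pdivlMr// expRN mulrC ler_pdivrMr ?expR_gt0//.
have h1 : 1 <= expR (b * w) by rewrite -expR0 ler_expR mulr_ge0// ltW.
have h2 : (s / tau) ^+ 2 <= expR (b * w).
  have -> : expR (b * w) = expR w `^ b.
    by rewrite /powR gt_eqF ?expR_gt0// expRK.
  have -> : (s / tau) ^+ 2 = (w ^+ 2) `^ b.
    by rewrite sE expr2 -powRM// -expr2.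
  by apply: ge0_ler_powR; rewrite ?nnegrE ?sqr_ge0 ?expR_ge0// ltW.
by rewrite mulr_natl mulr2n lerD.
Qed.

(** A block longer than its natural size by the factor [e / rho] is only long
    enough to gain [- N] in the exponent; the gain is independent of [b] because
    [(e / rho) `^ b^-1 >= 1 + (1 - ln rho) / b]. *)
Lemma rate_block N rho l : 2 <= N -> 0 < rho -> rho <= 1 ->
  expR 1 * tau * N `^ b / rho <= l ->
  expR (- (b * (l / tau) `^ b^-1)) <= expR (- (b * N) - N) * rho ^+ 2.
Proof.
move=> N2 r0 r1 ll; have N0 : 0 < N by apply: lt_le_trans N2.
have lt0 : 0 < expR 1 * tau * N `^ b / rho.
  by rewrite divr_gt0// !mulr_gt0// ?expR_gt0 ?powR_gt0.
have ge : N * (1 + b^-1 * (1 - ln rho)) <= (l / tau) `^ b^-1.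
  apply: (@le_trans _ _ ((N `^ b * (expR 1 / rho)) `^ b^-1)).
    rewrite powRM ?powR_ge0 ?divr_ge0 ?expR_ge0 ?(ltW r0)//.
    rewrite -powRrM mulfV ?gt_eqF// powRr1 ?(ltW N0)// ler_pM2l//.
    have -> : (expR 1 / rho) `^ b^-1 = expR (b^-1 * (1 - ln rho)).
      by rewrite /powR gt_eqF ?divr_gt0 ?expR_gt0// ln_div ?posrE ?expR_gt0// expRK.
    exact: expR_ge1Dx.
  apply: ge0_ler_powR; rewrite ?nnegrE ?invr_ge0 ?(ltW b0)//.
  - by rewrite mulr_ge0 ?powR_ge0// divr_ge0 ?expR_ge0// ltW.
  - by rewrite divr_ge0 ?(ltW tau0)// (le_trans _ ll)// ltW.
  - rewrite ler_pdivlMr//; apply: le_trans ll.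
    by rewrite le_eqVlt; apply/orP; left; apply/eqP; ring.
have lnr : ln rho <= 0 by rewrite -ln1 ler_ln ?posrE.
have -> : rho ^+ 2 = expR (2 * ln rho).
  by rewrite mulr_natl mulr2n expRD lnK ?posrE// expr2.
rewrite -expRD ler_expR.
have h : b * N + N - N * ln rho <= b * (l / tau) `^ b^-1.
  have := ler_wpM2l (ltW b0) ge; apply: le_trans.
  rewrite le_eqVlt; apply/orP; left; apply/eqP; field; by rewrite gt_eqF.
have : 2 * - ln rho <= N * - ln rho by rewrite ler_wpM2r// oppr_ge0.
by lra.
Qed.

End rate.

Section constants.
Context {R : realType}.
Implicit Types (c b N : R).

(** [256 * c * pi] collects the second moments of the blocks, and [12 * expR 1 * b]
    bounds the variation of the exponent over three blocks; only its value at
    [b = 1] matters, by [powR_dominates]. *)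
Definition growth_constant c : R := 256 * c * pi * expR (12 * expR 1).

Definition threshold c : R :=
  expR (12 * expR 1 + 2) + growth_constant c + expR (8 * expR 1) +
  (144 + 128 * expR 1) * c.

Lemma growth_constant_ge0 c : 0 < c -> 0 <= growth_constant c.
Proof.
move=> c0; have h : 0 <= c * pi * expR (12 * expR 1).
  by rewrite mulr_ge0 ?expR_ge0// mulr_ge0 ?pi_ge0// ltW.
by rewrite /growth_constant -mulrA -mulrA mulr_ge0// mulrA.
Qed.

Lemma threshold_gt0 c : 0 < c -> 0 < threshold c.
Proof.
move=> c0; have g0 := growth_constant_ge0 c0.
have h0 : 0 < expR (12 * expR 1 + 2) :> R := expR_gt0 _.
have h1 : 0 < expR (8 * expR 1) :> R := expR_gt0 _.
have h2 : 0 < expR 1 * c by rewrite mulr_gt0 ?expR_gt0.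
by rewrite /threshold; lra.
Qed.

Lemma threshold_le c N : 0 < c -> threshold c <= N ->
  [/\ expR (12 * expR 1 + 2) <= N, 8 * expR 1 <= N, 2 <= N &
      growth_constant c + (expR (8 * expR 1) + (144 + 128 * expR 1) * c) <= N].
Proof.
move=> c0 cN; have g0 := growth_constant_ge0 c0.
have e1 : 0 < expR 1 :> R := expR_gt0 _.
have h1 : 0 <= (144 + 128 * expR 1) * c.
  by rewrite mulr_ge0 ?(ltW c0)// addr_ge0// mulr_ge0// ltW.
have h2 : 0 <= expR (8 * expR 1) :> R := expR_ge0 _.
have h3 : 0 <= expR (12 * expR 1 + 2) :> R := expR_ge0 _.
have h4 := expR_ge1Dx (12 * expR 1 + 2 : R).
by move: cN; rewrite /threshold => cN; split; lra.
Qed.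

(** The ratio of the two sides is 1 or more at [b = 1], and then the base [N] of the
    power wins: [b ^ 2] is absorbed by [expR (2 * (b - 1))]. This is what makes the
    threshold independent of [p]. *)
Lemma powR_dominates b N : 1 <= b -> expR (12 * expR 1 + 2) <= N ->
  N * b ^+ 2 * expR (12 * expR 1 * (b - 1)) <= N `^ b.
Proof.
move=> b1 CN; have N0 : 0 < N by apply: lt_le_trans CN; exact: expR_gt0.
have -> : N `^ b = N * N `^ (b - 1).
  by rewrite mulr_powRB1 ?(ltW N0)//; apply: lt_le_trans b1.
rewrite -mulrA ler_pM2l//.
have b0 : 0 <= b - 1 by rewrite subr_ge0.
apply: (@le_trans _ _ (expR (12 * expR 1 + 2) `^ (b - 1))); last first.
  by apply: ge0_ler_powR; rewrite ?nnegrE ?expR_ge0// ltW.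
rewrite {1}/powR gt_eqF ?expR_gt0// expRK.
have -> : (b - 1) * (12 * expR 1 + 2) = ((b - 1) + (b - 1)) + 12 * expR 1 * (b - 1) by ring.
rewrite [leRHS]expRD ler_wpM2r ?expR_ge0// expRD expr2.
have bb : b <= expR (b - 1) by apply: le_trans (expR_ge1Dx _); rewrite addrC subrK.
have b00 : 0 <= b by apply: le_trans b1.
exact: ler_pM.
Qed.

(** The arithmetic of the choice [lam * rho * t = 4 * b * N], with the blocks
    between once and twice their minimal length: the total growth stays bounded, and
    the initial value and the decorrelation errors are both below
    [expR (- (b * N))] with a margin [expR (- N)] that absorbs the constants. *)
Lemma deviation_arithmetic c b tau rho t N q l n (alpha : R -> R) pr :
  0 < c -> 1 <= b -> 0 < tau -> 0 < rho -> rho <= 1 -> 0 < t -> threshold c <= N ->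
  rho ^+ 2 * t = 4 * tau * N * q ->
  N * b ^+ 2 * expR (12 * expR 1 * (b - 1)) <= q ->
  l <= 2 * (expR 1 * tau * q / rho) -> 0 < l -> n%:R * l = t ->
  0 <= alpha l -> alpha l <= c * (expR (- (b * N) - N) * rho ^+ 2) ->
  0 <= pr ->
  let lam := 4 * b * N / (rho * t) in
  let x0 := rho * t / 2 in
  let m := 2 * lam * l in
  2 * m <= lam * x0 /\
  (pr * (lam * (rho * t - x0)) ^+ 2 / 2 <=
   (expR (2 * m - lam * x0) + n%:R * block_error 2 alpha l lam n) *
     expR (n%:R * block_growth 2 (2 * c * tau * pi) l lam) ->
   pr <= expR (- (b * N))).
Proof.
move=> c0 b1 tau0 r0 r1 t0 cN rtE qN lq l0 nl a0 al pr0 lam x0 m.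
have [CN N8 N2 GN] := threshold_le c0 cN.
set e := expR 1 in N8 lq *.
have e0 : 0 < e by exact: expR_gt0.
have b0 : 0 < b by apply: lt_le_trans b1.
have N0 : 0 < N by apply: lt_le_trans N2.
have q0 : 0 < q.
  by apply: lt_le_trans qN; rewrite !mulr_gt0// ?expR_gt0// exprn_gt0.
have lamx : lam * x0 = 2 * b * N by rewrite /lam /x0; field; rewrite !gt_eqF.
have lamh : lam * (rho * t - x0) = 2 * b * N.
  by rewrite /lam /x0; field; rewrite !gt_eqF.
have lam0 : 0 < lam by rewrite /lam divr_gt0// !mulr_gt0.
have lamt : lam * t = 4 * b * N / rho by rewrite /lam; field; rewrite !gt_eqF.
have laml : lam * l <= 2 * e * b.
  apply: (@le_trans _ _ (lam * (2 * (e * tau * q / rho)))); first by rewrite ler_pM2l.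
  have -> : lam * (2 * (e * tau * q / rho)) = 8 * b * N * e * tau * q / (rho ^+ 2 * t).
    by rewrite /lam; field; rewrite !gt_eqF.
  rewrite rtE le_eqVlt; apply/orP; left; apply/eqP; field; by rewrite !gt_eqF.
have m4 : m <= 4 * e * b by rewrite /m; lra.
have mle : 2 * m <= lam * x0.
  rewrite lamx; have h : 8 * e * b <= N * b by rewrite ler_pM2r.
  have : 0 < N * b by rewrite mulr_gt0.
  by lra.
split => // ineq.
pose G := expR (- (b * N) - N).
have G0 : 0 < G by exact: expR_gt0.
have growth : n%:R * block_growth 2 (2 * c * tau * pi) l lam <= growth_constant c.
  have -> : n%:R * block_growth 2 (2 * c * tau * pi) l lam =
      64 * c * pi * tau * (lam * (lam * t)) * expR (3 * m).
    by rewrite /block_growth /m -nl; ring.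
  have -> : lam * (lam * t) = 16 * b ^+ 2 * N ^+ 2 / (rho ^+ 2 * t).
    by rewrite lamt /lam; field; rewrite !gt_eqF.
  rewrite rtE; have -> : 64 * c * pi * tau * (16 * b ^+ 2 * N ^+ 2 / (4 * tau * N * q)) =
      256 * c * pi * (N * b ^+ 2 / q) by field; rewrite !gt_eqF.
  have c1 : 0 <= 256 * c * pi.
    by have : 0 <= c * pi by [rewrite mulr_ge0 ?pi_ge0// ltW]; lra.
  rewrite /growth_constant -/e -[leLHS]mulrA ler_wpM2l//.
  apply: (@le_trans _ _ (N * b ^+ 2 / q * expR (12 * e * b))).
    rewrite ler_wpM2l//; last by rewrite ler_expR; lra.
    by rewrite divr_ge0 ?(ltW q0)// mulr_ge0 ?sqr_ge0// ltW.
  rewrite mulrAC ler_pdivrMr//.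
  have -> : 12 * e * b = 12 * e * (b - 1) + 12 * e by ring.
  by rewrite expRD mulrA [leRHS]mulrC ler_wpM2r ?expR_ge0.
have bN1 : 1 <= b * N by rewrite -[leLHS]mulr1; apply: ler_pM => //; lra.
have bN0 : 0 < b * N by rewrite mulr_gt0.
have T0 : 0 <= lam * t by rewrite mulr_ge0// ltW.
have L0 : 0 <= lam * l by rewrite mulr_ge0// ltW.
have errE : n%:R * block_error 2 alpha l lam n =
    alpha l * (8 * (lam * t) * (1 + 2 * (lam * t)) + 32 * (lam * t) * (lam * l)).
  by rewrite /block_error -nl; ring.
have err0 : 0 <= 8 * (lam * t) * (1 + 2 * (lam * t)) + 32 * (lam * t) * (lam * l).
  by move: (lam * t) (lam * l) T0 L0 => T L T0 L0; rewrite !(addr_ge0, mulr_ge0).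
have error : n%:R * block_error 2 alpha l lam n <=
    c * G * ((b * N) ^+ 2 * (288 + 256 * e)).
  rewrite errE; apply: (@le_trans _ _ (c * (G * rho ^+ 2) *
      (8 * (lam * t) * (1 + 2 * (lam * t)) + 32 * (lam * t) * (2 * e * b)))).
    apply: (ler_pM a0 err0 al).
    by rewrite lerD2l ler_wpM2l// mulr_ge0.
  have -> : c * (G * rho ^+ 2) *
      (8 * (lam * t) * (1 + 2 * (lam * t)) + 32 * (lam * t) * (2 * e * b)) =
      c * G * (32 * rho * (b * N) + 256 * (b * N) ^+ 2 + 256 * e * b * rho * (b * N)).
    by rewrite lamt; field; rewrite !gt_eqF.
  rewrite ler_wpM2l ?mulr_ge0 ?(ltW c0) ?(ltW G0)//.
  have h1 : rho * (b * N) <= (b * N) ^+ 2.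
    by rewrite expr2 ler_pM2r// (le_trans r1).
  have h2 : b * rho * (b * N) <= (b * N) ^+ 2.
    rewrite expr2 ler_pM2r// ler_wpM2l ?(ltW b0)// (le_trans r1)//; lra.
  have h3 : e * (b * rho * (b * N)) <= e * (b * N) ^+ 2 by rewrite ler_pM2l.
  by lra.
pose H := expR (8 * e) + (144 + 128 * e) * c.
have init : expR (2 * m - lam * x0) <= expR (8 * e) * G.
  rewrite /G -expRD ler_expR lamx.
  have : 8 * e * (b - 1) <= N * (b - 1) by rewrite ler_wpM2r// subr_ge0.
  by lra.
have bN2 : 1 <= (b * N) ^+ 2 by exact: exprn_ege1.
have main : pr * (b * N) ^+ 2 <= H * G * expR (growth_constant c) * (b * N) ^+ 2.
  apply: (@le_trans _ _ ((expR (8 * e) * G + c * G * ((b * N) ^+ 2 * (288 + 256 * e)))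
       * expR (growth_constant c) / 2)).
    rewrite ler_pdivlMr//.
    have -> : pr * (b * N) ^+ 2 * 2 = pr * (lam * (rho * t - x0)) ^+ 2 / 2.
      by rewrite lamh; field.
    apply: le_trans ineq _.
    apply: ler_pM; rewrite ?expR_ge0 ?ler_expR//; last exact: lerD.
    by rewrite addr_ge0 ?expR_ge0// errE mulr_ge0.
  have -> : H * G * expR (growth_constant c) * (b * N) ^+ 2 =
     (H * G * (b * N) ^+ 2 * 2) * expR (growth_constant c) / 2 by field.
  rewrite ler_pM2r ?invr_gt0// ler_pM2r ?expR_gt0//.
  have -> : H * G * (b * N) ^+ 2 * 2 = expR (8 * e) * G * (2 * (b * N) ^+ 2) +
     c * G * ((b * N) ^+ 2 * (288 + 256 * e)) by rewrite /H; ring.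
  rewrite lerD2r -[leLHS]mulr1 ler_pM2l; first by lra.
  by rewrite mulr_gt0// expR_gt0.
rewrite ler_pM2r in main; last by apply: lt_le_trans bN2.
apply: le_trans main _.
have HH : H <= expR H by apply: le_trans (expR_ge1Dx H); rewrite lerDr.
apply: (@le_trans _ _ (expR H * G * expR (growth_constant c))).
  by rewrite !ler_pM2r// expR_gt0.
rewrite /G -!expRD ler_expR.
by move: GN; rewrite -/e -/H; lra.
Qed.

End constants.
Section parameters.
Context {R : realType}.
Variables (p c' : R).
Hypotheses (p_gt0 : 0 < p) (p_le1 : p <= 1) (c'_gt0 : 0 < c').

Let b := (2 - p) / p.
Let tau := (b / c') `^ b.

Let p2_gt0 : 0 < 2 - p.
Proof. by have := p_le1; lra. Qed.

Let b_gt0 : 0 < b.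
Proof. by rewrite /b divr_gt0. Qed.

Let bc_gt0 : 0 < b / c'.
Proof. by rewrite divr_gt0. Qed.

Lemma rate_exponent s : 0 <= s ->
  c' * s `^ (p / (2 - p)) = b * (s / tau) `^ b^-1.
Proof.
move=> s0; have -> : p / (2 - p) = b^-1 by rewrite /b invf_div.
rewrite powRM// ?invr_ge0 ?powR_ge0//.
rewrite -(powR_inv1 (powR_ge0 _ b : 0 <= tau)) /tau -!powRrM.
have -> : b * (-1 * b^-1) = -1 by field; rewrite gt_eqF.
by rewrite powR_inv1 ?(ltW bc_gt0)//; field; rewrite !gt_eqF.
Qed.

Lemma sqrt_time_scale :
  ((2 - p) / (p * c')) `^ ((2 - p) / (2 * p)) = Num.sqrt tau.
Proof.
rewrite -powR12_sqrt ?powR_ge0// /tau -powRrM /b; congr (_ `^ _).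
  by field; rewrite !gt_eqF.
by field; rewrite gt_eqF.
Qed.

Lemma deviation_exponent x : 0 <= x ->
  (2 - p) / p * (1 / 2) `^ p * (p * c' / (2 - p)) `^ ((2 - p) / 2) * x `^ p =
  b * (x / (2 * Num.sqrt tau)) `^ p.
Proof.
move=> x0; rewrite -/b -!mulrA; congr (_ * _).
have -> : (p * (c' / (2 - p))) `^ ((2 - p) / 2) = ((Num.sqrt tau)^-1) `^ p.
  rewrite -powR12_sqrt ?powR_ge0// -(powR_inv1 (powR_ge0 tau 2^-1)) /tau -!powRrM.
  have -> : p * (c' / (2 - p)) = (b / c') `^ (-1).
    by rewrite powR_inv1 ?(ltW bc_gt0)// /b; field; rewrite !gt_eqF.
  by rewrite -powRrM /b; congr (_ `^ _); field; rewrite gt_eqF.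
have st0 : 0 < Num.sqrt tau by rewrite sqrtr_gt0 powR_gt0.
have sx0 : 0 <= (Num.sqrt tau)^-1 * x by rewrite mulr_ge0// invr_ge0 ltW.
have -> : x / (2 * Num.sqrt tau) = 1 / 2 * ((Num.sqrt tau)^-1 * x).
  by field; rewrite gt_eqF.
by rewrite !powRM// invr_ge0 ltW.
Qed.

End parameters.

(** * The deviation bound *)

Theorem proposition3p9 (R : realType) (c : R) (c_gt0 : 0 < c) :
  exists k0 : R, 0 < k0 /\
  forall (E : ptopologicalType) (polishE : polish R E)
    (dO : measure_display) (Om : measurableType dO)
    (X : R -> Om -> borelType E) (Px : R.-pker (borelType E) ~> Om)
    (markovX : markov_process X Px)
    (mu : probability (borelType E) R)
    (inv_mu : invariant_measure X Px mu) (erg_mu : ergodic_measure X Px mu)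
    (eta : R -> R)
    (eta_noninc : forall s t : R, 0 <= s -> s <= t -> eta t <= eta s)
    (eta_var : forall f : borelType E -> R,
       measurable_fun [set: borelType E] f ->
       (exists M : R, forall x, `|f x| <= M) ->
       forall t : R, 0 <= t ->
       variance_under mu (semigroup X Px t f) <=
         eta t * supnorm (fun x => f x - \int[mu]_y f y) ^+ 2)
    (alpha : R -> R)
    (alphaE : (forall s : R, 0 <= s -> alpha s = Num.sqrt (eta s)) \/
      (symmetric_measure X Px mu /\
        forall s : R, 0 <= s -> alpha s = eta (s / 2)))
    (p c' : R) (p_gt0 : 0 < p) (p_le1 : p <= 1) (c'_gt0 : 0 < c')
    (alpha_exp : forall s : R, 0 <= s ->
       alpha s = c * expR (- (c' * s `^ (p / (2 - p)))))
    (V : borelType E -> R) (mV : measurable_fun [set: borelType E] V)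
    (supV : supnorm V = 1)
    (r t : R) (r_gt0 : 0 < r) (r_le1 : r <= 1)
    (t_gt0 : 0 < t) (level_gt0 : 0 < reduced_level r t)
    (large : 2 * k0 `^ p^-1 *
               ((2 - p) / (p * c')) `^ ((2 - p) / (2 * p)) <=
             reduced_level r t * Num.sqrt t),
  let cp := (2 - p) / p * (1 / 2) `^ p *
              (p * c' / (2 - p)) `^ ((2 - p) / 2) in
  (law_from Px mu
     [set w | (r <= t^-1 *
                 (\int[@lebesgue_measure R]_(s in `[0, t]) V (X s w))
               - \int[mu]_x V x)%R]
   <= (expR (- (cp * (reduced_level r t * Num.sqrt t) `^ p)))%:E)%E.
Proof.
exists (threshold c); split; first exact: threshold_gt0.
move=> E polishE dO Om X Px markovX mu inv_mu erg_mu eta eta_noninc eta_var.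
move=> alpha alphaE p c' p_gt0 p_le1 c'_gt0 alpha_exp V mV supV r t.
move=> r_gt0 r_le1 t_gt0 level_gt0 large; cbv zeta.
(* in terms of [b] and the time scale [tau] the rate is
   [c * expR (- (b * (s / tau) `^ b^-1))], and the claim is [expR (- (b * N))] *)
pose b := (2 - p) / p; pose tau := (b / c') `^ b.
set rho := reduced_level r t in level_gt0 large *.
have b1 : 1 <= b by rewrite /b ler_pdivlMr//; lra.
have b0 : 0 < b by apply: lt_le_trans b1.
have tau0 : 0 < tau by rewrite powR_gt0// divr_gt0.
have st0 : 0 < Num.sqrt tau by rewrite sqrtr_gt0.
have rho_r : rho <= r.
  rewrite /rho /reduced_level gerBl subr_ge0 ler_pdivrMr// mul1r.
  exact: Num.Theory.floor_le_tmp.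
have rho1 : rho <= 1 by exact: le_trans r_le1.
pose z := rho * Num.sqrt t / (2 * Num.sqrt tau).
have z0 : 0 < z by rewrite divr_gt0 ?mulr_gt0 ?sqrtr_gt0.
pose N := z `^ p; pose q := N `^ b.
have qE : q = N `^ b by [].
have N0 : 0 < N by rewrite powR_gt0.
have q0 : 0 < q by rewrite powR_gt0.
rewrite (deviation_exponent p_gt0 p_le1 c'_gt0); last first.
  by rewrite mulr_ge0 ?sqrtr_ge0// ltW.
rewrite -/b -/tau -/z -/N.
have cN : threshold c <= N.
  have k0 := threshold_gt0 c_gt0.
  have : threshold c `^ p^-1 <= z.
    rewrite /z ler_pdivlMr ?mulr_gt0// mulrCA mulrA -(sqrt_time_scale p_gt0 c'_gt0)//.
  move=> h; have : (threshold c `^ p^-1) `^ p <= N.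
    by apply: ge0_ler_powR; rewrite ?nnegrE ?powR_ge0// ltW.
  by rewrite -powRrM mulVf ?gt_eqF// powRr1// ltW.
have rtE : rho ^+ 2 * t = 4 * tau * N * q.
  have -> : 4 * tau * N * q = 4 * tau * z ^+ 2.
    rewrite -[LHS]mulrA; congr (_ * _).
    rewrite /q /N -powRrM -powRD; last by rewrite (gt_eqF z0) implybT.
    have -> : p + p * b = 2%:R by rewrite /b; field; rewrite gt_eqF.
    by rewrite powR_mulrn// ltW.
  rewrite /z exprMn exprVn !exprMn !sqr_sqrtr ?(ltW t_gt0) ?(ltW tau0)//.
  by field; rewrite gt_eqF.
have alphaR s : 0 <= s -> alpha s = c * expR (- (b * (s / tau) `^ b^-1)).
  move=> s0; rewrite alpha_exp//; congr (c * expR (- _)).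
  exact: (rate_exponent p_gt0 p_le1 c'_gt0).
clearbody q N z tau b.
have [CN N8 N2 _] := threshold_le c_gt0 cN.
have qN : N * b ^+ 2 * expR (12 * expR 1 * (b - 1)) <= q.
  by rewrite qE; exact: powR_dominates.
have e0 : 0 < expR 1 :> R := expR_gt0 _.
(* [tau * q], the time after which the rate is [c * expR (- (b * N))], is
   the natural length of a block; the factor [expR 1 / rho] gains [expR (- N) * rho ^+ 2] *)
pose l0 := expR 1 * tau * q / rho.
have l0_gt0 : 0 < l0 by rewrite divr_gt0// !mulr_gt0.
have tl0 : 1 <= t / l0.
  rewrite ler_pdivlMr// mul1r /l0 ler_pdivrMr//.
  have -> : t * rho = (4 * tau * N * q) / rho by rewrite -rtE; field; rewrite gt_eqF.
  rewrite ler_pdivlMr//.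
  have : expR 1 * rho <= 4 * N by nra.
  have : 0 < tau * q by rewrite mulr_gt0.
  by nra.
pose n := Num.trunc (t / l0).
have n0 : (0 < n)%N by rewrite Num.Theory.truncn_gt0.
have nR : 0 < n%:R :> R by rewrite ltr0n.
have /andP[n1 n2] : n%:R <= t / l0 < n.+1%:R by apply: Num.Theory.truncn_itv; lra.
pose l := t / n%:R.
have l_gt0 : 0 < l by rewrite divr_gt0.
have nl : n%:R * l = t by rewrite /l mulrC divfK// gt_eqF.
have l0l : l0 <= l by rewrite /l ler_pdivlMr// mulrC -ler_pdivlMr.
have l2l0 : l <= 2 * l0.
  rewrite /l ler_pdivrMr// mulrAC -ler_pdivrMr//; apply: (le_trans (ltW n2)).
  by rewrite -natr1; have : 1 <= n%:R :> R by [rewrite ler1n]; lra.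
have alpha_gt0 s : 0 <= s -> 0 < alpha s.
  by move=> s0; rewrite alphaR// mulr_gt0// expR_gt0.
have alpha_noninc s u : 0 <= s -> s <= u -> alpha u <= alpha s.
  move=> s0 su; have u0 := le_trans s0 su.
  rewrite !alphaR// ler_pM2l// ler_expR lerN2 ler_pM2l//.
  have st x : 0 <= x -> 0 <= x / tau by move=> x0; rewrite divr_ge0// ltW.
  apply: ge0_ler_powR; rewrite ?nnegrE ?st//; first by rewrite invr_ge0 ltW.
  by rewrite ler_pM2r// invr_gt0.
have V1 := norm_le_supnorm1 supV.
have mu1 : mu setT = 1%E := probability_setT mu.
have bV : bounded_mfun V by split => //; exists 1.
set m := \int[mu]_x V x.
pose f := fun x => V x - m.
have bf : bounded_mfun f by apply: bounded_mfunB => //; exact: bounded_mfun_cst.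
have f2 x : `|f x| <= 2.
  rewrite (le_trans (ler_normB _ _))// (_ : 2 = 1 + 1)// lerD//.
  exact: norm_expect_le.
have f0 : \int[mu]_x f x = 0.
  by rewrite expectB ?expect_cst ?subrr//; exact: bounded_mfun_cst.
have mX : measurable_fun
    ([set s | 0 <= s.1] : set (measurableTypeR R * Om))
    (fun s : measurableTypeR R * Om => X s.1 s.2) by have [] := markovX.
have c20 : 0 <= 2 * c by rewrite mulr_ge0// ltW.
have alpha_beta x : alpha `|x| <= cauchy_kernel (2 * c) tau x.
  have -> : cauchy_kernel (2 * c) tau x = c * (2 * (1 + (x / tau) ^+ 2)^-1).
    by rewrite /cauchy_kernel mulrA (mulrC c).
  rewrite alphaR// ler_pM2l//.
  apply: le_trans (rate_le_cauchy b1 tau0 (normr_ge0 x)) _.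
  by rewrite expr_div_n real_normK ?num_real// -expr_div_n.
pose B := [set w | rho * t <= path_integral X f 0 t w].
have mB : measurable B.
  apply: measurable_le_set => //.
  by case: (path_integral_bounded mX (path_law Px mu) t bf (lexx 0)).
have al_le : alpha l <= c * (expR (- (b * N) - N) * rho ^+ 2).
  rewrite alphaR ?(ltW l_gt0)// ler_pM2l//; apply: rate_block => //.
  by rewrite -qE.
have prB : fine (path_law Px mu B) <= expR (- (b * N)).
  have l_le : l <= 2 * (expR 1 * tau * q / rho) by [].
  have pr0 : 0 <= fine (path_law Px mu B) by rewrite fine_ge0// measure_ge0.
  have [mle concl] := deviation_arithmetic c_gt0 b1 tau0 level_gt0 rho1 t_gt0 cN
    rtE qN l_le l_gt0 nl (ltW (alpha_gt0 _ (ltW l_gt0))) al_le pr0.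
  apply: concl.
  have lam0 : 0 < 4 * b * N / (rho * t).
    by rewrite (divr_gt0 (mulr_gt0 (mulr_gt0 _ b0) N0) (mulr_gt0 level_gt0 t_gt0)).
  have x00 : 0 <= rho * t / 2 by rewrite divr_ge0// mulr_ge0// ltW.
  have x0h : rho * t / 2 <= rho * t.
    by rewrite ler_pdivrMr// ler_peMr ?ler1n// mulr_ge0// ltW.
  have := block_deviation markovX inv_mu bf (ltr0n _ 2) f2 f0
    (fun s s0 => ltW (alpha_gt0 s s0)) alpha_noninc
    (semigroup_L1 markovX inv_mu eta_var alphaE alpha_gt0) alpha_beta
    (fun a d u => cauchy_kernel_integrable (2 * c) tau a d u)
    (fun a d u ad => cauchy_kernel_int c20 tau0 u ad)
    n l_gt0 lam0 x00 mle x0h.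
  by rewrite nl.
have AB : [set w | (r <= t^-1 * (\int[@lebesgue_measure R]_(s in `[0, t]) V (X s w))
    - m)%R] `<=` B.
  move=> w /= rw; rewrite /B/=.
  have iV := path_bounded_integrable mX t bV (lexx 0) w.
  have -> : path_integral X f 0 t w =
      \int[@lebesgue_measure R]_(s in `[0, t]) V (X s w) - m * t.
    rewrite /path_integral /f RintegralB//; last first.
      exact: (path_bounded_integrable mX t (bounded_mfun_cst _ m) (lexx 0) w).
    rewrite Rintegral_cst//= lebesgue_measure_itv/= lte_fin t_gt0.
    by rewrite /= subr0.
  have rhow := le_trans rho_r rw; move: rhow.
  set I := \int[_]_(_ in _) _ => rhow.
  have -> : I - m * t = (t^-1 * I - m) * t by field; rewrite gt_eqF.
  by rewrite ler_pM2r.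
have mA : measurable [set w | (r <= t^-1 *
    (\int[@lebesgue_measure R]_(s in `[0, t]) V (X s w)) - m)%R].
  apply: measurable_le_set => //; apply: measurable_funB => //.
  apply: measurable_funM => //.
  by case: (path_integral_bounded mX (path_law Px mu) t bV (lexx 0)).
apply: (@le_trans _ _ (path_law Px mu B)).
  by apply: (le_measure (path_law Px mu)); rewrite ?inE.
by rewrite -(fineK (fin_num_measure (path_law Px mu) B mB)) lee_fin.
Qed.
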